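(* Let $(\mathfrak{M},\tau)$ be a noncommutative probability space and let $\left\{s_n=\sum_{i=1}^n x_i,\ n\geq 0\right\}$ be a self-adjoint supermartingale in $\mathfrak{M}$ with respect to a filtration $(\mathfrak{M}_n,\mathcal{E}_n)_{n\geq 0}$ (so $s_0=0$). Let $\lambda>0$ and $\gamma\geq 0$ be constants and let $f$ be a continuous positive function on $[0,\infty)$ such that for all $n\geq 1$ and all $t>0$ $$\mathcal{E}_{n-1}(e^{t x_n})\leq f(t)\leq e^{-\gamma t+\lambda t^2}.$$ Let $a$ and $b$ be positive numbers. Then there exists an integer $i\geq 1$ such that for every positive integer $m$ $$\tau\left( \bigvee_{n=m+i}^\infty \mathbf{1}_{(a+bn, \infty)} (s_n) \right) \leq A^m e^{\frac{-a(b+\gamma)}{\lambda}},$$ where $A=e^{-bt_0}f(t_0) \leq 1$ and $t_0=\frac{b+\gamma}{\lambda}$. Moreover, there exists an integer $j\geq 1$ such that for every positive integer $m$ $$\tau\left( \bigvee_{n=m+j}^\infty \mathbf{1}_{(bn, \infty)} (s_n) \right) \leq A_0^m e^{\frac{-m(b+\gamma)^2}{4\lambda}},$$ where $A_0 =e^{-\frac{1}{2}(b-\gamma)t_0'}f(t_0')$ and $t_0'=\frac{b+ \gamma}{2\lambda}$.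
   Context: A noncommutative probability space is a von Neumann algebra $\mathfrak{M}$ on a Hilbert space, with unit $1$, equipped with a normal faithful tracial state $\tau:\mathfrak{M}\to\mathbb{C}$. The symbol $\leq$ denotes the usual order on the self-adjoint part of $\mathfrak{M}$, and a scalar $c$ in an operator inequality means $c\cdot 1$. For self-adjoint $x\in\mathfrak{M}$ and a Borel set $B\subseteq\mathbb{R}$, $\mathbf{1}_B(x)$ is the spectral projection of $x$ corresponding to $B$; $\bigvee$ denotes the supremum in the lattice of projections. For a von Neumann subalgebra $\mathfrak{N}\subseteq\mathfrak{M}$, the conditional expectation $\mathcal{E}_{\mathfrak{N}}:\mathfrak{M}\to\mathfrak{N}$ is the unique normal positive contractive projection with $\mathcal{E}_{\mathfrak{N}}(axb)=a\mathcal{E}_{\mathfrak{N}}(x)b$ for $x\in\mathfrak{M}$, $a,b\in\mathfrak{N}$, and $\tau\circ\mathcal{E}_{\mathfrak{N}}=\tau$. A filtration $(\mathfrak{M}_n,\mathcal{E}_n)_{n\ge 0}$ of $\mathfrak{M}$ is an increasing sequence of von Neumann subalgebras $\mathfrak{M}_n$ of $\mathfrak{M}$ with $\bigcup_n\mathfrak{M}_n$ $w^*$-dense in $\mathfrak{M}$, together with the conditional expectations $\mathcal{E}_n$ of $\mathfrak{M}$ with respect to $\mathfrak{M}_n$. A self-adjoint supermartingale in $\mathfrak{M}$ with respect to this filtration is a sequence $(s_n)_{n\ge0}$ of self-adjoint elements $s_n\in\mathfrak{M}_n$ with $\mathcal{E}_n(s_{n+1})\leq s_n$ for all $n\geq 0$.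 *)

(* Defs.v *)
From mathcomp Require Export all_boot all_order all_algebra.
From mathcomp Require Export sesquilinear.
From mathcomp Require Export complex.
From mathcomp Require Export all_classical all_reals all_analysis.
Export numFieldNormedType.Exports.
Export Order.TTheory GRing.Theory Num.Theory.

Set Implicit Arguments.
Unset Strict Implicit.
Unset Printing Implicit Defensive.

Local Open Scope classical_set_scope.
Local Open Scope ring_scope.
Local Open Scope complex_scope.

(* A complex Hilbert space is a complete normed space [H] over [R[i]] together
   with a positive definite hermitian form [dot] inducing its norm.  The form
   is linear in its first argument.  Operators are functions [H -> H], with
   the pointwise vector space structure; boundedness is a predicate. *)

Section Order.
Context {T : Type}.
Variable le : T -> T -> Prop.

Definition is_lub (S D : set T) (y : T) : Prop :=
  [/\ S y, forall z, D z -> le z y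
    & forall w, S w -> (forall z, D z -> le z w) -> le y w].

Definition directed (D : set T) : Prop :=
  D !=set0 /\ forall y z, D y -> D z -> exists2 w, D w & le y w /\ le z w.

End Order.

Section Operators.
Context {R : realType} {H : completeNormedModType R[i]}.
Variable dot : {dot H for @Num.conj R[i]}.
Implicit Types (x y p : H -> H) (M N : set (H -> H)).

Definition hilbert_norm : Prop := forall u : H, `|u| ^+ 2 = dot u u.

Definition bounded_op : set (H -> H) :=
  [set x | linear x /\ exists c : R[i], forall u, `|x u| <= c * `|u| ].

Definition is_adjoint x y : Prop := forall u v, dot (x u) v = dot u (y v).

Definition selfadjoint x : Prop := bounded_op x /\ is_adjoint x x.

(* On [R[i]], [0 <= z] means that [z] is real and nonnegative. *)
Definition op_le x y : Prop := forall u, 0 <= dot (y u - x u) u.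

Definition projection p : Prop := selfadjoint p /\ p \o p = p.

Definition commutant M : set (H -> H) :=
  [set x | bounded_op x /\ forall y, M y -> x \o y = y \o x].

Definition von_neumann_algebra M : Prop :=
  [/\ M `<=` bounded_op,
      forall x, M x -> exists2 y, M y & is_adjoint x y
    & commutant (commutant M) = M].

Definition selfadjoint_part M : set (H -> H) := M `&` selfadjoint.

Definition linear_on {V : lmodType R[i]} M (phi : (H -> H) -> V) : Prop :=
  forall (c : R[i]) x y, M x -> M y -> phi (c *: x + y) = c *: phi x + phi y.

(* Normality is preservation of suprema of increasing bounded nets. *)
Definition normal_map {T : Type} M (le : T -> T -> Prop) (S : set T)
    (phi : (H -> H) -> T) : Prop :=
  forall (D : set (H -> H)) x, D `<=` selfadjoint_part M -> directed op_le D ->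
    is_lub op_le (selfadjoint_part M) D x -> is_lub le S (phi @` D) (phi x).

Record normal_faithful_tracial_state M (tau : (H -> H) -> R[i]) : Prop := {
  state_linear : @linear_on R[i]^o M tau ;
  state_pos : forall x, M x -> op_le 0 x -> 0 <= tau x ;
  state_unit : tau id = 1 ;
  state_normal : normal_map M (fun z w : R[i] => z <= w) setT tau ;
  state_faithful : forall x, M x -> op_le 0 x -> tau x = 0 -> x = 0 ;
  state_tracial : forall x y, M x -> M y -> tau (x \o y) = tau (y \o x) }.

Record conditional_expectation M (tau : (H -> H) -> R[i]) N
    (E : (H -> H) -> (H -> H)) : Prop := {
  ce_range : forall x, M x -> N (E x) ;
  ce_id : forall x, N x -> E x = x ;
  ce_linear : linear_on M E ;
  ce_normal : normal_map M op_le (selfadjoint_part N) E ;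
  ce_pos : forall x, M x -> op_le 0 x -> op_le 0 (E x) ;
  ce_contractive : forall x (c : R[i]), M x ->
    (forall u, `|x u| <= c * `|u|) -> forall u, `|E x u| <= c * `|u| ;
  ce_bimodule : forall x y z, M x -> N y -> N z ->
    E (y \o x \o z) = y \o E x \o z ;
  ce_trace : forall x, M x -> tau (E x) = tau x }.

(* The w*-continuous functionals are the maps
   [x |-> \sum_k <x u_k, v_k>] with square summable [u] and [v]. *)
Definition square_summable (u : nat -> H) : Prop :=
  cvgn (series (fun k => `|u k| ^+ 2 : R[i]^o)).

Definition w_star_functional (phi : (H -> H) -> R[i]) : Prop :=
  exists u v : nat -> H, [/\ square_summable u, square_summable v
    & forall x, bounded_op x ->
        series (fun k => dot (x (u k)) (v k) : R[i]^o) @ \oo --> (phi x : R[i]^o)].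

Definition w_star_dense N M : Prop :=
  forall x, M x -> forall (n : nat) (phi : 'I_n -> (H -> H) -> R[i]) (e : R),
    (forall k, w_star_functional (phi k)) -> 0 < e ->
    exists2 y, N y & forall k, `|phi k y - phi k x| < e%:C.

Record filtration M (tau : (H -> H) -> R[i]) (N : nat -> set (H -> H))
    (E : nat -> (H -> H) -> (H -> H)) : Prop := {
  filt_vna : forall n, von_neumann_algebra (N n) ;
  filt_sub : forall n, N n `<=` M ;
  filt_incr : forall n, N n `<=` N n.+1 ;
  filt_dense : w_star_dense (\bigcup_n N n) M ;
  filt_ce : forall n, conditional_expectation M tau (N n) (E n) }.

Definition supermartingale (N : nat -> set (H -> H))
    (E : nat -> (H -> H) -> (H -> H)) (s : nat -> H -> H) : Prop :=
  (forall n, selfadjoint_part (N n) (s n)) /\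
  (forall n, op_le (E n (s n.+1)) (s n)).

(* For bounded [x] the series converges in operator norm, hence pointwise to
   the same sum. *)
Definition op_exp x : H -> H :=
  fun u => limn (series (fun k => (k`!%:R : R[i])^-1 *: iter k x u)).

(* [P] is a projection-valued measure on the Borel sets of the real line with
   [x = \int t dP(t)], the integral being taken in the weak sense; the values
   of [P] at sets that are not Borel are irrelevant. *)
Record spectral_measure x (P : set R -> (H -> H)) : Prop := {
  sm_proj : forall B : set R, measurable B -> projection (P B) ;
  sm_setT : P setT = id ;
  sm_setI : forall A B : set R, measurable A -> measurable B ->
    P (A `&` B) = P A \o P B ;
  sm_sigma_additive : forall F : nat -> set R,
    (forall k, measurable (F k)) -> trivIset setT F ->
    forall u, series (fun k => P (F k) u) @ \oo --> P (\bigcup_k F k) u ;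
  sm_integral : forall u,
    exists mu : {measure set (measurableTypeR R) -> \bar R},
    [/\ forall B : set R, measurable B -> (mu B = (complex.Re (dot (P B u) u))%:E)%E,
        mu.-integrable setT (fun t : R => t%:E)
      & dot (x u) u = (\int[mu]_(t in setT) t)%:C] }.

(* By the spectral theorem a spectral measure of a self-adjoint [x] exists and
   is unique on Borel sets. *)
Definition spectral_projection (B : set R) x : H -> H :=
  xget (fun _ => 0) [set P | spectral_measure x P] B.

(* The projections of a von Neumann algebra form a complete lattice. *)
Definition projection_sup M (D : set (H -> H)) : H -> H :=
  xget 0 (is_lub op_le (M `&` projection) D).

End Operators.

(* Main.v *)
From HB Require Import structures.
Require Import Defs.
From mathcomp Require Import ring lra zify.

(** The proof is the exponential moment method followed by a union bound.

    Write [e^x] for the operator exponential and fix [t > 0].  The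
    Golden-Thompson inequality, the module property of [E (n-1)] and the
    hypothesis on [e^(t x_n)] give
    [tau e^(t s_n) <= tau (e^(t s_(n-1)) e^(t x_n))
                    = tau (e^(t s_(n-1)) E_(n-1)(e^(t x_n)))
                   <= f t * tau e^(t s_(n-1))]
    ([tr_expe_add_le]), whence [tau e^(t s_n) <= (f t)^n].  On the range of the
    spectral projection [p_n] of [s_n] for the half-line above [c_n] the
    operator [e^(t s_n)] is at least [e^(t c_n)], so
    [tau p_n <= e^(- t c_n) (f t)^n], which for [c_n = a + b n] is
    [e^(- t a) r^n] with [r = e^(- b t) f t].  The trace is countably
    subadditive on projections, so the supremum over [n >= N] has trace at most
    [e^(- t a) r^N / (1 - r)] as soon as [r < 1].  At [t = t0'] the bound on
    [f] gives [r < 1], and [j] is chosen with [r^j <= 1 - r].  At [t = t0] it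
    only gives [A <= 1]; when [A = 1] the choice [t = t0 / 2] has [r < 1], and
    [i] can be taken so large that [r^i] absorbs the constant factors.

    Three ingredients carry the weight.

    - Golden-Thompson ([golden_thompson]).  For self-adjoint [p], [q] and
      [n = 2^k] one has [tr ((p q)^n) <= tr (p^n q^n)], an inequality that only
      uses the positivity and cyclicity of the trace ([trace_expr_mul_le]).  It
      is applied to [p = 1 + x / n] and [q = 1 + y / n]; all three powers
      involved converge in norm.

    - Spectral projections.  If the self-adjoint [s] has a spectral measure,
      its projections commute with [s] ([sm_commute]) and those of half-lines
      belong to the algebra ([spectral_half_line_mem]).  The latter is shown by
      comparing the growth of [s^n] on the ranges of two projections that [s]
      separates ([separated_ranges]).  Without a spectral measure the
      projection under consideration is [0] by definition.

    - Subadditivity ([tau_projection_sup_le]).  For projections [p_k] put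
      [T = \sum_k 2^-(k+1) p_k].  The powers [(1 - T)^K] decrease strongly to
      the projection [q] onto the kernel of [T], and [1 - q] dominates every
      [p_k].  Moreover
      [1 - (1 - T)^K = \sum_k 2^-(k+1) p_k X] with [X] at most the inverse of
      [T], and [T >= 2^-(k+1) p_k] forces [2^-(k+1) p_k X p_k <= p_k]
      ([compression_le]).  Hence [tau (1 - (1 - T)^K) <= \sum_k tau p_k], and
      the normality of [tau] passes this to the limit.

    Elements of the algebra form a ring [elt V], and analytic estimates are
    made with the real part [ip] of the inner product. *)

Set Implicit Arguments.
Unset Strict Implicit.
Unset Printing Implicit Defensive.

Local Open Scope classical_set_scope.
Local Open Scope ring_scope.
Local Open Scope complex_scope.

(** * Traces of powers in a ring with involution *)

Section TracePowers.
Context {R : realType} {A : pzRingType}.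
Variables (adj : A -> A) (T : A -> R).
Hypothesis adjB : forall x y, adj (x - y) = adj x - adj y.
Hypothesis adjM : forall x y, adj (x * y) = adj y * adj x.
Hypothesis adjK : forall x, adj (adj x) = x.
Hypothesis TB : forall x y, T (x - y) = T x - T y.
Hypothesis TC : forall x y, T (x * y) = T (y * x).
Hypothesis Tadj : forall x, T (adj x) = T x.
Hypothesis T_ge0 : forall x, 0 <= T (adj x * x).

Let adj1 : adj 1 = 1.
Proof. by rewrite -[adj 1]mulr1 -{2}[1]adjK -adjM mulr1 adjK. Qed.

Lemma adjX x n : adj (x ^+ n) = adj x ^+ n.
Proof. by elim: n => [|n IH]; rewrite ?expr0 // exprS adjM IH -exprSr. Qed.

(** Cauchy-Schwarz in additive form, from the positivity of [(x - y)^* (x - y)]. *)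
Lemma trace_mul_le x y : 2 * T (adj x * y) <= T (adj x * x) + T (adj y * y).
Proof.
have := T_ge0 (x - y); rewrite adjB mulrBl !mulrBr !TB.
have -> : T (adj y * x) = T (adj x * y) by rewrite -Tadj adjM adjK.
lra.
Qed.

(** Rotating the word [x y x y ... x y] by one letter. *)
Lemma trace_expr_mulC x y n : T ((x * y) ^+ n) = T ((y * x) ^+ n).
Proof.
case: n => [|n]; first by rewrite !expr0.
have E m : (x * y) ^+ m * x = x * (y * x) ^+ m.
  elim: m => [|m IH]; first by rewrite !expr0 mul1r mulr1.
  by rewrite exprSr -!mulrA (mulrA x y x) -[x * y * x]mulrA mulrA IH -mulrA exprSr !mulrA.
by rewrite exprSr mulrA E TC mulrA -exprS.
Qed.

(** One step of squaring: [trace_power_le] for [w = p * q] gives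
    [T ((p q)^(2m)) <= T ((q p p q)^m) = T ((p^2 q^2)^m)], and [p^2], [q^2] are
    again self-adjoint.  The instances of [trace_power_le] used are a hypothesis
    because that lemma is proved by an induction which calls this one. *)
Lemma trace_selfadj_powers p q n : adj p = p -> adj q = q ->
  (forall m, (m <= n)%N -> forall w,
      T (w ^+ (2 ^ m.+1)) <= T ((adj w * w) ^+ (2 ^ m))) ->
  T ((p * q) ^+ (2 ^ n.+1)) <= T (p ^+ (2 ^ n.+1) * q ^+ (2 ^ n.+1)).
Proof.
elim: n p q => [|n IH] p q hp hq hT.
  apply: (le_trans (hT 0%N (leqnn _) _)).
  by rewrite expn0 !expr1 adjM hp hq -mulrA TC !expr2 !mulrA.
apply: (le_trans (hT n.+1 (leqnn _) _)).
have -> : T ((adj (p * q) * (p * q)) ^+ (2 ^ n.+1)) = T ((p ^+ 2 * q ^+ 2) ^+ (2 ^ n.+1)).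
  by rewrite adjM hp hq -mulrA trace_expr_mulC !expr2 !mulrA.
rewrite (expnS 2 n.+1) !exprM; apply: IH; rewrite ?adjX ?hp ?hq // => m lemn.
exact/hT/leqW.
Qed.

(** The analogue of the bound of a power trace by a Schatten norm.  With
    [p = w^* w] and [q = w w^*], the induction hypothesis for [w^2] bounds the
    trace by [T ((p q)^m)], hence by [T (p^m q^m)], hence by the mean of
    [T (p^(2m))] and [T (q^(2m))]; the last two agree by cyclicity. *)
Lemma trace_power_le n w : T (w ^+ (2 ^ n.+1)) <= T ((adj w * w) ^+ (2 ^ n)).
Proof.
elim/ltn_ind: n w => -[|n] IH w.
  have := trace_mul_le (adj w) w.
  by rewrite adjK expn1 expn0 expr1 expr2 [T (w * adj w)]TC; lra.
rewrite (expnS 2 n.+1) exprM.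
apply: (le_trans (IH n (leqnn _) _)); rewrite adjX.
have -> : T ((adj w ^+ 2 * w ^+ 2) ^+ (2 ^ n)) =
          T (((adj w * w) * (w * adj w)) ^+ (2 ^ n)).
  by rewrite expr2 -[in LHS]mulrA trace_expr_mulC expr2 !mulrA.
set p := adj w * w; set q := w * adj w.
have hp : adj p = p by rewrite adjM adjK.
have hq : adj q = q by rewrite adjM adjK.
have : T ((p * q) ^+ (2 ^ n)) <= T (p ^+ (2 ^ n) * q ^+ (2 ^ n)).
  case: n IH => [|n] IH; first by rewrite expn0 !expr1.
  by apply: trace_selfadj_powers => // m lemn v; apply: IH; rewrite ltnS ltnW.
move=> /le_trans; apply.
have := trace_mul_le (p ^+ (2 ^ n)) (q ^+ (2 ^ n)).
rewrite !adjX hp hq -!exprD addnn -mul2n -expnS.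
rewrite /q -[in T ((w * adj w) ^+ _)]trace_expr_mulC -/p; lra.
Qed.

Theorem trace_expr_mul_le p q n : adj p = p -> adj q = q ->
  T ((p * q) ^+ (2 ^ n)) <= T (p ^+ (2 ^ n) * q ^+ (2 ^ n)).
Proof.
move=> hp hq; case: n => [|n]; first by rewrite expn0 !expr1.
by apply: trace_selfadj_powers => // m _ w; apply: trace_power_le.
Qed.

End TracePowers.

(** * The underlying real Hilbert space *)

Section RealHilbert.
Context {R : realType} {H : completeNormedModType R[i]}.
Variable dot : {dot H for @Num.conj R[i]}.
Hypothesis dot_norm : hilbert_norm dot.

(** Real parts avoid the partial order on complex scalars; a symmetric real form
    determines everything needed about self-adjoint operators. *)
Definition ip (u v : H) : R := complex.Re (dot u v).
Definition nrm (u : H) : R := complex.Re `|u|.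

Lemma ReD (x y : R[i]) : complex.Re (x + y) = complex.Re x + complex.Re y.
Proof. by case: x y => a b [c d]. Qed.

Lemma ReB (x y : R[i]) : complex.Re (x - y) = complex.Re x - complex.Re y.
Proof. by case: x y => a b [c d]. Qed.

Lemma ReN (x : R[i]) : complex.Re (- x) = - complex.Re x.
Proof. by case: x. Qed.

Lemma ReZ (a : R) (x : R[i]) : complex.Re (a%:C * x) = a * complex.Re x.
Proof. by case: x => b c /=; rewrite mul0r subr0. Qed.

Lemma ReJ (x : R[i]) : complex.Re (Num.conj x) = complex.Re x.
Proof. by case: x. Qed.

Lemma nrmE u : `|u| = (nrm u)%:C.
Proof. by rewrite /nrm RRe_real // normr_real. Qed.

Lemma nrm_ge0 u : 0 <= nrm u.
Proof. by rewrite -lecR -nrmE normr_ge0. Qed.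

Lemma ler_nrmD u v : nrm (u + v) <= nrm u + nrm v.
Proof. by rewrite -lecR rmorphD /= -!nrmE ler_normD. Qed.

Lemma nrmN u : nrm (- u) = nrm u.
Proof. by rewrite /nrm normrN. Qed.

Lemma nrmBC u v : nrm (u - v) = nrm (v - u).
Proof. by rewrite -nrmN opprB. Qed.

Lemma nrm0 : nrm 0 = 0.
Proof. by rewrite /nrm normr0. Qed.

Lemma nrmZ (c : R) u : 0 <= c -> nrm (c%:C *: u) = c * nrm u.
Proof.
move=> c0; apply: complexI; rewrite rmorphM /= -!nrmE normrZ.
by rewrite ger0_norm // ler0c.
Qed.

Lemma nrm_eq0 u : nrm u = 0 -> u = 0.
Proof. by move=> h; apply/eqP; rewrite -normr_eq0 nrmE h. Qed.

Lemma nrm_sqr u : nrm u ^+ 2 = ip u u.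
Proof.
apply: complexI; rewrite rmorphXn /= -nrmE dot_norm /ip RRe_real //.
by rewrite ger0_real ?dnorm_ge0.
Qed.

Lemma ipDl u v w : ip (u + v) w = ip u w + ip v w.
Proof. by rewrite /ip linearDl /= ReD. Qed.
Lemma ipDr u v w : ip w (u + v) = ip w u + ip w v.
Proof. by rewrite /ip linearDr /= ReD. Qed.
Lemma ipNl u w : ip (- u) w = - ip u w.
Proof. by rewrite /ip linearNl /= ReN. Qed.
Lemma ipNr u w : ip w (- u) = - ip w u.
Proof. by rewrite /ip linearNr /= ReN. Qed.
Lemma ipBl u v w : ip (u - v) w = ip u w - ip v w.
Proof. by rewrite ipDl ipNl. Qed.
Lemma ipBr u v w : ip w (u - v) = ip w u - ip w v.
Proof. by rewrite ipDr ipNr. Qed.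
Lemma ip0l u : ip 0 u = 0.
Proof. by rewrite -(subrr u) ipBl subrr. Qed.
Lemma ip0r u : ip u 0 = 0.
Proof. by rewrite -(subrr u) ipBr subrr. Qed.
Lemma ipZl (c : R) u v : ip (c%:C *: u) v = c * ip u v.
Proof. by rewrite /ip linearZl_LR /= ReZ. Qed.
Lemma ipC u v : ip u v = ip v u.
Proof. by rewrite /ip hermC expr0 mul1r ReJ. Qed.
Lemma ipZr (c : R) u v : ip u (c%:C *: v) = c * ip u v.
Proof. by rewrite ipC ipZl ipC. Qed.

Lemma ip_ge0 u : 0 <= ip u u.
Proof. by rewrite -nrm_sqr sqr_ge0. Qed.

Lemma ip_eq0 u : ip u u = 0 -> u = 0.
Proof. by move/eqP; rewrite -nrm_sqr sqrf_eq0 => /eqP/nrm_eq0. Qed.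

Lemma ip_le_nrm u v : ip u v <= nrm u * nrm v.
Proof.
have [u0|u0] := eqVneq (nrm u) 0; first by rewrite (nrm_eq0 u0) ip0l nrm0 mul0r.
have [v0|v0] := eqVneq (nrm v) 0; first by rewrite (nrm_eq0 v0) ip0r nrm0 mulr0.
have pu : 0 < nrm u by rewrite lt_def u0 nrm_ge0.
have pv : 0 < nrm v by rewrite lt_def v0 nrm_ge0.
have := ip_ge0 ((nrm v)%:C *: u - (nrm u)%:C *: v).
have -> : ip ((nrm v)%:C *: u - (nrm u)%:C *: v) ((nrm v)%:C *: u - (nrm u)%:C *: v)
    = 2 * (nrm u * nrm v) * (nrm u * nrm v - ip u v).
  by rewrite !(ipBl, ipBr, ipZl, ipZr) -!nrm_sqr (ipC v u); ring.
by rewrite pmulr_rge0 ?subr_ge0 // !mulr_gt0.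
Qed.

Lemma cvgHP (u : nat -> H) l :
  u @ \oo --> l <-> forall e, 0 < e -> exists n0, forall n, (n0 <= n)%N -> nrm (u n - l) < e.
Proof.
split=> [/cvgrPdist_lt h e e0|h].
  have [n0 _ hn] := h e%:C (ltac:(by rewrite ltcR)).
  by exists n0 => n /hn /=; rewrite nrmE ltcR nrmBC.
apply/cvgrPdist_lt => -[e e'] e0.
have e0' : 0 < e by move: e0; rewrite ltcE /= => /andP[].
have [n0 hn] := h e e0'; exists n0 => // n /hn.
rewrite /= nrmE nrmBC ltcE /= => ->; rewrite andbT.
by move: e0; rewrite ltcE /= => /andP[].
Qed.

Lemma cauchyH (u : nat -> H) :
  (forall e, 0 < e -> exists n0, forall n m, (n0 <= n)%N -> (n0 <= m)%N -> nrm (u n - u m) < e) ->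
  exists l : H, u @ \oo --> l.
Proof.
move=> h; suff hc : cauchy (u @ \oo).
  by exists (lim (u @ \oo)); exact: cauchy_cvg hc.
apply/cauchy_exP => -[e e'] e0.
have e0' : 0 < e by move: e0; rewrite ltcE /= => /andP[].
have [n0 hn] := h e e0'.
exists (u n0); exists n0 => // n /= le_n.
rewrite -ball_normE /ball_ /= nrmE ltcE /= hn // andbT.
by move: e0; rewrite ltcE /= => /andP[].
Qed.

Lemma cvgH_unique (u : nat -> H) (l l' : H) : u @ \oo --> l -> u @ \oo --> l' -> l = l'.
Proof. by move=> h h'; apply: (cvg_unique _ h h'); exact: norm_hausdorff. Qed.

Lemma lim_ip_ge (u : nat -> H) (l v : H) (a : R) n0 : u @ \oo --> l ->
  (forall n, (n0 <= n)%N -> a <= ip (u n) v) -> a <= ip l v.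
Proof.
move=> /cvgHP h ha; rewrite leNgt; apply/negP => lt_a.
have v1 : 0 < nrm v + 1 by rewrite ltr_wpDl ?nrm_ge0.
have [n1 hn] := h ((a - ip l v) / (nrm v + 1)) (ltac:(by rewrite divr_gt0 ?subr_gt0)).
have := ha (maxn n0 n1) (leq_maxl _ _).
have := hn _ (leq_maxr n0 n1); rewrite ltr_pdivlMr // => h1.
have -> : ip (u (maxn n0 n1)) v = ip (u (maxn n0 n1) - l) v + ip l v by rewrite ipBl subrK.
have := ip_le_nrm (u (maxn n0 n1) - l) v; have := nrm_ge0 (u (maxn n0 n1) - l); nra.
Qed.

Lemma lim_ip_le (u : nat -> H) (l v : H) (a : R) n0 : u @ \oo --> l ->
  (forall n, (n0 <= n)%N -> ip (u n) v <= a) -> ip l v <= a.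
Proof.
move=> h ha; rewrite -lerN2 -ipNl; apply: (@lim_ip_ge (fun n => - u n) _ _ _ n0); first exact: cvgN.
by move=> n /ha; rewrite ipNl lerN2.
Qed.

Lemma cvg_ip (u : nat -> H) (l v : H) : u @ \oo --> l ->
  (fun n => ip (u n) v) @ \oo --> ip l v.
Proof.
move=> /cvgHP h; apply/cvgrPdist_lt => e e0.
have v1 : 0 < nrm v + 1 by rewrite ltr_wpDl ?nrm_ge0.
have [n0 hn] := h (e / (nrm v + 1)) (ltac:(by rewrite divr_gt0)).
exists n0 => // n /hn; rewrite ltr_pdivlMr //= -ipBl => h1.
have h2 := ip_le_nrm (l - u n) v; have h3 := ip_le_nrm (- (l - u n)) v.
move: h2 h3; rewrite ipNl nrmN nrmBC => h2 h3.
have := nrm_ge0 (u n - l); have := nrm_ge0 v.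
by rewrite ltr_norml => ? ?; apply/andP; split; nra.
Qed.

(** Polarization at [u] and [y u] already suffices. *)
Lemma quad_eq0 (y : H -> H) : (forall u v, y (u + v) = y u + y v) ->
  (forall u v, ip (y u) v = ip u (y v)) -> (forall u, ip (y u) u = 0) ->
  forall u, y u = 0.
Proof.
move=> yD ya y0 u; apply: ip_eq0.
have := y0 (u + y u).
rewrite yD !(ipDl, ipDr) !y0 -ya; lra.
Qed.

Lemma lim_nrm_le (u : nat -> H) (l : H) (a : R) n0 : u @ \oo --> l ->
  (forall n, (n0 <= n)%N -> nrm (u n) <= a) -> nrm l <= a.
Proof.
move=> h ha; have [l0|l0] := eqVneq (nrm l) 0.
  by rewrite l0; apply: le_trans (ha n0 (leqnn _)); apply: nrm_ge0.
have pl : 0 < nrm l by rewrite lt_def l0 nrm_ge0.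
have := @lim_ip_le u l l (a * nrm l) n0 h.
rewrite -nrm_sqr expr2 ler_pM2r //; apply => n /ha un.
by apply: (le_trans (ip_le_nrm _ _)); rewrite ler_pM2r.
Qed.

End RealHilbert.

(** * Bounded operators *)

Section BoundedOperators.
Context {R : realType} {H : completeNormedModType R[i]}.
Implicit Types (x y : H -> H).

(** An operator norm bound with a real constant. *)
Definition bnd x (C : R) : Prop := 0 <= C /\ forall u, nrm (x u) <= C * nrm u.

Lemma bounded_opE x : bounded_op x <-> linear x /\ exists C, bnd x C.
Proof.
split=> -[lx [c hc]]; split=> //.
  exists `|complex.Re c|; split=> // u.
  have := hc u; rewrite !nrmE mulrC lecE => /andP[_]; rewrite ReZ /= mulrC.
  by move/le_trans; apply; rewrite ler_wpM2r ?nrm_ge0 ?ler_norm.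
by exists c%:C => u; rewrite !nrmE -rmorphM lecR; apply: hc.2.
Qed.

Lemma bnd_le x C D : bnd x C -> C <= D -> bnd x D.
Proof.
move=> [C0 hC] CD; split=> [|u]; first exact: le_trans CD.
by apply: (le_trans (hC u)); rewrite ler_wpM2r ?nrm_ge0.
Qed.

Lemma linD x : linear x -> forall u v, x (u + v) = x u + x v.
Proof. by move=> lx u v; have := lx 1 u v; rewrite !scale1r. Qed.

Lemma lin0 x : linear x -> x 0 = 0.
Proof. by move=> lx; have := lx (-1) 0 0; rewrite scaleN1r oppr0 addr0 scaleN1r addNr. Qed.

Lemma linZ x : linear x -> forall c u, x (c *: u) = c *: x u.
Proof. by move=> lx c u; have := lx c u 0; rewrite (lin0 lx) !addr0. Qed.

Lemma linN x : linear x -> forall u, x (- u) = - x u.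
Proof. by move=> lx u; rewrite -scaleN1r (linZ lx) scaleN1r. Qed.

Lemma linB x : linear x -> forall u v, x (u - v) = x u - x v.
Proof. by move=> lx u v; rewrite (linD lx) (linN lx). Qed.

Lemma bounded_op_cvg x (u : nat -> H) (l : H) : bounded_op x ->
  u @ \oo --> l -> (fun n => x (u n)) @ \oo --> x l.
Proof.
move=> /bounded_opE[lx [C [C0 hC]]] /cvgHP h; apply/cvgHP => e e0.
have C1 : 0 < C + 1 by rewrite ltr_wpDl.
have [n0 hn] := h (e / (C + 1)) (ltac:(by rewrite divr_gt0)).
exists n0 => n /hn; rewrite ltr_pdivlMr // -(linB lx) => h1.
by apply: (le_lt_trans (hC _)); have := nrm_ge0 (u n - l); nra.
Qed.

End BoundedOperators.

(** * A von Neumann algebra as a ring *)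

Section VNA.
Context {R : realType} {H : completeNormedModType R[i]}.
Variable dot : {dot H for @Num.conj R[i]}.

(** Bundling the proof makes the ring structure of [elt] canonical. *)
Record vna := Vna { vset :> set (H -> H); vsetP : von_neumann_algebra dot vset }.

Variable V : vna.

Lemma vset_bounded x : vset V x -> bounded_op x.
Proof. by case: (vsetP V) => h _ _; apply: h. Qed.

Lemma vset_comm x y : vset V x -> commutant V y -> forall u, x (y u) = y (x u).
Proof. by move=> Vx [_ hy] u; have /(congr1 (@^~ u)) := hy _ Vx. Qed.

(** The double commutant condition is used only through this criterion; it is how
    limits and spectral projections are put into the algebra. *)
Lemma vset_mem x : bounded_op x ->
  (forall y, commutant V y -> forall u, x (y u) = y (x u)) -> vset V x.
Proof.
move=> bx hx; case: (vsetP V) => _ _ <-; split=> // y Vy; apply/funext => u.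
exact: hx.
Qed.

Lemma commutant_linear y : commutant V y -> linear y.
Proof. by case=> -[]. Qed.

Lemma vset0 : vset V (fun _ => 0).
Proof.
apply: vset_mem => [|y [[ly _] _] u]; last by rewrite lin0.
apply/bounded_opE; split=> [c u v|]; first by rewrite scaler0 addr0.
by exists 0; split=> // u; rewrite nrm0 mul0r.
Qed.

Lemma vset1 : vset V id.
Proof.
apply: vset_mem => // ; apply/bounded_opE; split=> //.
by exists 1; split=> // u; rewrite mul1r.
Qed.

Lemma vsetD x y : vset V x -> vset V y -> vset V (fun u => x u + y u).
Proof.
move=> Vx Vy; apply: vset_mem => [|z Cz u].
  have /bounded_opE[lx [C [C0 hC]]] := vset_bounded Vx.
  have /bounded_opE[ly [D [D0 hD]]] := vset_bounded Vy.
  apply/bounded_opE; split=> [c u v|]; first by rewrite lx ly scalerDr addrACA.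
  exists (C + D); split=> [|u]; first exact: addr_ge0.
  by apply: (le_trans (ler_nrmD _ _)); rewrite mulrDl; apply: lerD; [exact: hC|exact: hD].
by rewrite (linD (commutant_linear Cz)) (vset_comm Vx Cz) (vset_comm Vy Cz).
Qed.

Lemma vsetZ (c : R[i]) x : vset V x -> vset V (fun u => c *: x u).
Proof.
move=> Vx; apply: vset_mem => [|z Cz u].
  have /bounded_opE[lx [C [C0 hC]]] := vset_bounded Vx.
  split=> [d u v|]; first by rewrite lx scalerDr !scalerA mulrC.
  exists (`|c| * C%:C) => u; rewrite normrZ -mulrA ler_wpM2l //.
  by rewrite !nrmE -rmorphM lecR.
by rewrite (linZ (commutant_linear Cz)) (vset_comm Vx Cz).
Qed.

Lemma vsetM x y : vset V x -> vset V y -> vset V (x \o y).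
Proof.
move=> Vx Vy; apply: vset_mem => [|z Cz u]; last by rewrite /= (vset_comm Vy Cz) (vset_comm Vx Cz).
have /bounded_opE[lx [C [C0 hC]]] := vset_bounded Vx.
have /bounded_opE[ly [D [D0 hD]]] := vset_bounded Vy.
apply/bounded_opE; split=> [c u v|]; first by rewrite /= ly lx.
exists (C * D); split=> [|u]; first exact: mulr_ge0.
by rewrite -mulrA; apply: (le_trans (hC _)); rewrite ler_wpM2l.
Qed.

Lemma vsetN x : vset V x -> vset V (fun u => - x u).
Proof.
move=> Vx; have -> : (fun u => - x u) = (fun u => (-1) *: x u).
  by apply/funext => u; rewrite scaleN1r.
exact: vsetZ.
Qed.

Lemma vset_cvg (z : nat -> H -> H) x : (forall n, vset V (z n)) -> bounded_op x ->
  (forall u, (fun n => z n u) @ \oo --> x u) -> vset V x.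
Proof.
move=> Vz bx zx; apply: vset_mem => // y Cy u.
apply: (@cvgH_unique _ _ (fun n => z n (y u))); first exact: zx.
have -> : (fun n => z n (y u)) = (fun n => y (z n u)).
  by apply/funext => n; rewrite (vset_comm (Vz n) Cy).
by apply: bounded_op_cvg => //; case: Cy.
Qed.

Definition elt := {x : H -> H | vset V x}.
Definition op (x : elt) : H -> H := sval x.
Definition mkelt x (Vx : vset V x) : elt := exist _ x Vx.

Lemma op_inj (x y : elt) : (forall u, op x u = op y u) -> x = y.
Proof.
case: x y => [x Vx] [y Vy] /= h; have e : x = y by apply/funext.
by case: y / e Vy h => Vy _; congr exist; exact: Prop_irrelevance.
Qed.

HB.instance Definition _ := gen_eqMixin elt.
HB.instance Definition _ := gen_choiceMixin elt.

Let add (x y : elt) : elt := mkelt (vsetD (svalP x) (svalP y)).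
Let opp (x : elt) : elt := mkelt (vsetN (svalP x)).
Let mul (x y : elt) : elt := mkelt (vsetM (svalP x) (svalP y)).
Let scale (c : R[i]) (x : elt) : elt := mkelt (vsetZ c (svalP x)).
Let zero : elt := mkelt vset0.
Let one : elt := mkelt vset1.

Lemma op_linear (x : elt) : linear (op x).
Proof. by case: (vset_bounded (svalP x)). Qed.

Let addA : associative add. Proof. by move=> x y z; apply: op_inj => u /=; rewrite addrA. Qed.
Let addC : commutative add. Proof. by move=> x y; apply: op_inj => u /=; rewrite addrC. Qed.
Let add0 : left_id zero add. Proof. by move=> x; apply: op_inj => u /=; rewrite add0r. Qed.
Let addN : left_inverse zero opp add. Proof. by move=> x; apply: op_inj => u /=; rewrite addNr. Qed.
HB.instance Definition _ := GRing.isZmodule.Build elt addA addC add0 addN.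

Let mulA : associative mul. Proof. by move=> x y z; apply: op_inj. Qed.
Let mul1 : left_id one mul. Proof. by move=> x; apply: op_inj. Qed.
Let mulr1 : right_id one mul. Proof. by move=> x; apply: op_inj. Qed.
Let mulDl : left_distributive mul add. Proof. by move=> x y z; apply: op_inj. Qed.
Let mulDr : right_distributive mul add.
Proof. by move=> x y z; apply: op_inj => u; exact: (linD (op_linear x)). Qed.
HB.instance Definition _ := GRing.Zmodule_isPzRing.Build elt mulA mul1 mulr1 mulDl mulDr.

Let scaleA : forall a b (x : elt), scale a (scale b x) = scale (a * b) x.
Proof. by move=> a b x; apply: op_inj => u /=; rewrite scalerA. Qed.
Let scale1 : left_id 1 scale. Proof. by move=> x; apply: op_inj => u /=; rewrite scale1r. Qed.
Let scaleDr : right_distributive scale +%R.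
Proof. by move=> a x y; apply: op_inj => u /=; rewrite scalerDr. Qed.
Let scaleDl : forall x : elt, {morph scale^~ x : a b / a + b}.
Proof. by move=> x a b; apply: op_inj => u /=; rewrite scalerDl. Qed.
HB.instance Definition _ := GRing.Zmodule_isLmodule.Build R[i] elt scaleA scale1 scaleDr scaleDl.

Implicit Types x y z : elt.
Lemma opD x y u : op (x + y) u = op x u + op y u. Proof. by []. Qed.
Lemma opN x u : op (- x) u = - op x u. Proof. by []. Qed.
Lemma opB x y u : op (x - y) u = op x u - op y u. Proof. by []. Qed.
Lemma opM x y u : op (x * y) u = op x (op y u). Proof. by []. Qed.
Lemma op0 u : op 0 u = 0. Proof. by []. Qed.
Lemma op1 u : op 1 u = u. Proof. by []. Qed.
Lemma opZ c x u : op (c *: x) u = c *: op x u. Proof. by []. Qed.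

Lemma op_bounded x : bounded_op (op x).
Proof. exact: vset_bounded (svalP x). Qed.

Lemma elt_scaleAl c x y : c *: (x * y) = (c *: x) * y.
Proof. by apply: op_inj. Qed.

Lemma elt_scaleAr c x y : c *: (x * y) = x * (c *: y).
Proof. by apply: op_inj => u; rewrite !(opZ, opM) (linZ (op_linear x)). Qed.

Lemma op_sum I (r : seq I) (P : pred I) (F : I -> elt) u :
  op (\sum_(i <- r | P i) F i) u = \sum_(i <- r | P i) op (F i) u.
Proof. by apply: (big_morph (fun x => op x u)). Qed.

Lemma opX x n u : op (x ^+ n) u = iter n (op x) u.
Proof. by elim: n => //= n IH; rewrite exprS opM IH. Qed.

End VNA.

(** * Adjoints, positivity and norm bounds *)

Section Adjoint.
Context {R : realType} {H : completeNormedModType R[i]}.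
Variable dot : {dot H for @Num.conj R[i]}.
Hypothesis dot_norm : hilbert_norm dot.
Variable V : vna dot.
Implicit Types x y z : elt V.
Local Notation ip := (ip dot).

Let adj_ex x : exists y : elt V, is_adjoint dot (op x) (op y).
Proof.
case: (vsetP V) => _ /(_ _ (svalP x)) [y Vy hy] _.
by exists (mkelt Vy).
Qed.

Definition adj x : elt V := sval (cid (adj_ex x)).

Lemma dot_adj x u v : dot (op x u) v = dot u (op (adj x) v).
Proof. exact: (svalP (cid (adj_ex x))). Qed.

Lemma ip_adj x u v : ip (op x u) v = ip u (op (adj x) v).
Proof. by rewrite /ip dot_adj. Qed.

Lemma elt_ipP x y : (forall u v, ip (op x u) v = ip (op y u) v) -> x = y.
Proof.
move=> h; apply: op_inj => u; apply/subr0_eq/(ip_eq0 dot_norm).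
by rewrite (ipBl dot) h subrr.
Qed.

Lemma adj_uniq x y : (forall u v, ip (op x u) v = ip u (op y v)) -> adj x = y.
Proof. by move=> h; apply: elt_ipP => u v; rewrite !(ipC _ _ v) -ip_adj h. Qed.

Lemma adjK x : adj (adj x) = x.
Proof. by apply: adj_uniq => u v; rewrite ipC -ip_adj ipC. Qed.

Lemma adjD x y : adj (x + y) = adj x + adj y.
Proof. by apply: adj_uniq => u v; rewrite !opD ipDl ipDr -!ip_adj. Qed.

Lemma adjN x : adj (- x) = - adj x.
Proof. by apply: adj_uniq => u v; rewrite !opN ipNl ipNr -!ip_adj. Qed.

Lemma adjB x y : adj (x - y) = adj x - adj y.
Proof. by rewrite adjD adjN. Qed.

Lemma adjM x y : adj (x * y) = adj y * adj x.
Proof. by apply: adj_uniq => u v; rewrite !opM -!ip_adj. Qed.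

Lemma adj1 : adj 1 = 1.
Proof. exact: adj_uniq. Qed.

Lemma adjZ (c : R) x : adj (c%:C *: x) = c%:C *: adj x.
Proof. by apply: adj_uniq => u v; rewrite !opZ ipZl ipZr -!ip_adj. Qed.

Lemma elt_adjX x n : adj (x ^+ n) = adj x ^+ n.
Proof. by elim: n => [|n IH]; rewrite ?expr0 ?adj1 // exprS adjM IH -exprSr. Qed.

Lemma selfadjP x : selfadjoint dot (op x) <-> adj x = x.
Proof.
split=> [[_ h]|h]; first by apply: adj_uniq => u v; rewrite /ip h.
by split; [exact: op_bounded|move=> u v; rewrite dot_adj h].
Qed.

Definition psd x : Prop := adj x = x /\ forall u, 0 <= ip (op x u) u.

Lemma dot_selfadj x u : adj x = x -> dot (op x u) u = (ip (op x u) u)%:C.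
Proof.
move=> h; have := dot_adj x u u; rewrite h [RHS](hermC dot) /= expr0 mul1r /ip.
by case: (dot _ _) => a b [] hb; apply/eqP; rewrite eq_complex /= eqxx; apply/eqP; lra.
Qed.

Lemma op_leP x y : adj x = x -> adj y = y ->
  op_le dot (op x) (op y) <-> forall u, ip (op x u) u <= ip (op y u) u.
Proof.
move=> hx hy; split=> h u.
  by have := h u; rewrite lecE => /andP[_]; rewrite linearBl /= ReB subr_ge0.
by rewrite linearBl /= !dot_selfadj // -rmorphB ler0c subr_ge0.
Qed.

Lemma psd_mul_adj x : psd (adj x * x).
Proof. by split=> [|u]; rewrite ?adjM ?adjK // opM ipC -ip_adj ip_ge0. Qed.

Lemma psd_conj x y : psd y -> psd (adj x * y * x).
Proof.
move=> [hy py]; split=> [|u]; first by rewrite !adjM adjK hy mulrA.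
by rewrite !opM ipC -ip_adj ipC.
Qed.

Lemma psdD x y : psd x -> psd y -> psd (x + y).
Proof.
move=> [hx px] [hy py]; split=> [|u]; first by rewrite adjD hx hy.
by rewrite opD ipDl addr_ge0.
Qed.

Lemma psdZ (c : R) x : 0 <= c -> psd x -> psd (c%:C *: x).
Proof.
move=> c0 [hx px]; split=> [|u]; first by rewrite adjZ hx.
by rewrite opZ ipZl mulr_ge0.
Qed.

Lemma psd1 : psd 1.
Proof. by split=> [|u]; rewrite ?adj1 // op1 ip_ge0. Qed.

Lemma bndD x y C D : bnd (op x) C -> bnd (op y) D -> bnd (op (x + y)) (C + D).
Proof.
move=> [C0 hC] [D0 hD]; split=> [|u]; first exact: addr_ge0.
by apply: (le_trans (ler_nrmD _ _)); rewrite mulrDl; apply: lerD; [exact: hC|exact: hD].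
Qed.

Lemma bndN x C : bnd (op x) C -> bnd (op (- x)) C.
Proof. by move=> [C0 hC]; split=> // u; rewrite opN nrmN. Qed.

Lemma bndM x y C D : bnd (op x) C -> bnd (op y) D -> bnd (op (x * y)) (C * D).
Proof.
move=> [C0 hC] [D0 hD]; split=> [|u]; first exact: mulr_ge0.
by rewrite -mulrA; apply: (le_trans (hC _)); apply: ler_wpM2l (hD _).
Qed.

Lemma bnd1 : bnd (op (1 : elt V)) 1.
Proof. by split=> // u; rewrite mul1r. Qed.

Lemma bnd0 : bnd (op (0 : elt V)) 0.
Proof. by split=> // u; rewrite mul0r op0 nrm0. Qed.

Lemma bndZ (c : R) x C : 0 <= c -> bnd (op x) C -> bnd (op (c%:C *: x)) (c * C).
Proof.
move=> c0 [C0 hC]; split=> [|u]; first exact: mulr_ge0.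
by rewrite opZ nrmZ // -mulrA; apply: ler_wpM2l (hC _).
Qed.

Lemma bndX x C n : bnd (op x) C -> bnd (op (x ^+ n)) (C ^+ n).
Proof.
move=> hC; elim: n => [|n IH]; first by rewrite !expr0; exact: bnd1.
by rewrite !exprS; apply: bndM.
Qed.

Lemma bnd_sum n (F : nat -> elt V) (C : nat -> R) :
  (forall i, (i < n)%N -> bnd (op (F i)) (C i)) ->
  bnd (op (\sum_(i < n) F i)) (\sum_(i < n) C i).
Proof.
elim: n => [|n IH] h; first by rewrite !big_ord0; exact: bnd0.
rewrite !big_ord_recr /=; apply: bndD; last exact: h.
by apply: IH => i lti; apply: h; rewrite ltnS ltnW.
Qed.

Lemma bnd_ex x : exists C, bnd (op x) C.
Proof. by have /bounded_opE[_] := op_bounded x. Qed.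

(** Every self-adjoint element is thus a difference of positive ones. *)
Lemma psd_addC x C : adj x = x -> bnd (op x) C -> psd (C%:C *: (1 : elt V) + x).
Proof.
move=> hx [C0 hC]; split=> [|u]; first by rewrite adjD adjZ adj1 hx.
rewrite opD opZ op1 ipDl ipZl -(nrm_sqr dot_norm).
have := ip_le_nrm dot_norm (- op x u) u; rewrite ipNl nrmN.
by have := hC u; have := nrm_ge0 u; nra.
Qed.

Lemma bnd_exprB x y C n : bnd (op x) C -> bnd (op y) C ->
  forall d, bnd (op (x - y)) d -> bnd (op (x ^+ n.+1 - y ^+ n.+1)) (n.+1%:R * d * C ^+ n).
Proof.
move=> hx hy d hd; elim: n => [|n IH]; first by rewrite !expr1 mul1r mulr1.
have -> : x ^+ n.+2 - y ^+ n.+2 = x * (x ^+ n.+1 - y ^+ n.+1) + (x - y) * y ^+ n.+1.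
  by rewrite mulrBr mulrBl -!exprS addrA subrK.
have -> : n.+2%:R * d * C ^+ n.+1 = C * (n.+1%:R * d * C ^+ n) + d * C ^+ n.+1.
  by rewrite -[n.+2]addn1 natrD exprS; ring.
by apply: bndD; apply: bndM => //; exact: bndX.
Qed.

End Adjoint.

(** * The trace *)

Section Trace.
Context {R : realType} {H : completeNormedModType R[i]}.
Variable dot : {dot H for @Num.conj R[i]}.
Hypothesis dot_norm : hilbert_norm dot.
Variable V : vna dot.
Variable tau : (H -> H) -> R[i].
Hypothesis tau_state : normal_faithful_tracial_state dot V tau.
Implicit Types x y z : elt V.
Local Notation ip := (ip dot).

Definition tr x : R := complex.Re (tau (op x)).

Lemma tauD x y : tau (op (x + y)) = tau (op x) + tau (op y).
Proof.
have := state_linear tau_state 1 (svalP x) (svalP y).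
by rewrite !scale1r => <-; congr tau; apply/funext => u /=; rewrite scale1r.
Qed.

Lemma tauZ c x : tau (op (c *: x)) = c * tau (op x).
Proof.
have V0 := svalP (0 : elt V).
have h0 : tau (op (0 : elt V)) = 0.
  by apply: (addrI (tau (op (0 : elt V)))); rewrite -tauD !addr0.
have := state_linear tau_state c (svalP x) V0.
move=> /= e; have {}e := etrans e (congr1 (fun w => c * tau (op x) + w) h0).
apply: etrans (etrans e (addr0 _)).
by congr tau; apply/funext => u /=; rewrite addr0.
Qed.

Lemma trD x y : tr (x + y) = tr x + tr y.
Proof. by rewrite /tr tauD ReD. Qed.

Lemma trN x : tr (- x) = - tr x.
Proof. by rewrite -scaleN1r /tr tauZ mulN1r ReN. Qed.

Lemma trB x y : tr (x - y) = tr x - tr y.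
Proof. by rewrite trD trN. Qed.

Lemma trZ (c : R) x : tr (c%:C *: x) = c * tr x.
Proof. by rewrite /tr tauZ ReZ. Qed.

Lemma tr1 : tr 1 = 1.
Proof. by rewrite /tr (state_unit tau_state). Qed.

Lemma tr0 : tr 0 = 0.
Proof. by rewrite -(subrr 0) trB subrr. Qed.

Lemma trC x y : tr (x * y) = tr (y * x).
Proof. by rewrite /tr (state_tracial tau_state (svalP x) (svalP y)). Qed.

Lemma psd_tau_ge0 x : psd x -> 0 <= tau (op x).
Proof.
move=> [hx px]; apply: (state_pos tau_state (svalP x)) => u.
by rewrite subr0 dot_selfadj // ler0c.
Qed.

Lemma psd_tr_ge0 x : psd x -> 0 <= tr x.
Proof. by move/psd_tau_ge0; rewrite lecE => /andP[]. Qed.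

(** Positivity makes [tau] real on [C + x] and on [C], hence on [x]. *)
Lemma tau_selfadj x : adj x = x -> tau (op x) = (tr x)%:C.
Proof.
move=> hx; have [C hC] := bnd_ex x.
have := psd_tau_ge0 (psd_addC dot_norm hx hC).
have := psd_tau_ge0 (psdZ dot_norm hC.1 (psd1 dot_norm V)).
rewrite tauD /tr lecE => /andP[/eqP e1 _]; rewrite lecE => /andP[/eqP e2 _].
move: e1 e2; case: (tau _) => a b; case: (tau _) => c d /= -> /eqP.
by rewrite add0r => /eqP ->.
Qed.

(** If [y] is skew-adjoint then ['i y] is self-adjoint and has a real trace. *)
Lemma tr_adj x : tr (adj x) = tr x.
Proof.
suff skew y : adj y = - y -> tr y = 0.
  apply/eqP; rewrite -subr_eq0 -trB; apply/eqP/skew.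
  by rewrite adjB // adjK // opprB.
move=> hy; have : adj ('i%C *: y) = 'i%C *: y.
  apply: (adj_uniq dot_norm) => u v; rewrite /ip !opZ linearZl_LR linearZr_LR /=.
  rewrite dot_adj hy opN linearNr /=; case: (dot _ _) => p q /=; ring.
move/tau_selfadj; rewrite tauZ /tr; case: (tau _) => p q /= [].
by move=> _; rewrite mul0r mul1r add0r.
Qed.

(** For [D > C] the positivity of [(D - x)^* (D - x)] and of [D^2 - x^* x] give
    [2 D tr x <= D^2 + tr (x^* x) <= 2 D^2]. *)
Lemma bnd_tr x C : bnd (op x) C -> tr x <= C.
Proof.
move=> hC; have [C0 hC0] := hC.
suff h e : 0 < e -> tr x <= C + e.
  by rewrite leNgt; apply/negP => lt_C; have := h ((tr x - C) / 2) (ltac:(lra)); lra.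
move=> e0; have D0 : 0 < C + e by rewrite ltr_wpDl.
set D := C + e in D0 *.
have p1 : 0 <= tr (adj (D%:C *: (1 : elt V) - x) * (D%:C *: (1 : elt V) - x)).
  exact: psd_tr_ge0 (psd_mul_adj dot_norm _).
have p2 : psd ((D ^+ 2)%:C *: (1 : elt V) - adj x * x).
  have [h _] := psd_mul_adj dot_norm x.
  split=> [|u]; first by rewrite adjB ?adjZ ?adj1 ?h.
  rewrite opB opZ op1 ipBl ipZl opM [ip (op (adj x) _) _]ipC -ip_adj -!nrm_sqr //.
  rewrite subr_ge0 -exprMn ler_sqr ?nnegrE ?nrm_ge0 ?mulr_ge0 ?nrm_ge0 ?(ltW D0) //.
  by apply: (le_trans (hC0 u)); rewrite ler_wpM2r ?nrm_ge0 // lerDl ltW.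
have := psd_tr_ge0 p2; rewrite trB trZ tr1 mulr1.
move: p1; rewrite adjB // adjZ // adj1 // mulrBl !mulrBr.
rewrite -!elt_scaleAl -!elt_scaleAr !mul1r mulr1 scalerA -rmorphM !trB !trZ tr1 tr_adj => h1 h2.
have : D * tr x <= D * D by lra.
by rewrite ler_pM2l.
Qed.

Lemma tr_le_lim x a : (forall e, 0 < e -> exists2 y, bnd (op (x - y)) e & tr y <= a) ->
  tr x <= a.
Proof.
move=> h; rewrite leNgt; apply/negP => lt_a.
have [y /bnd_tr] := h ((tr x - a) / 2) (ltac:(lra)).
by rewrite trB; lra.
Qed.

Lemma psd_tr_mul_sqr v y : adj v = v -> psd y -> 0 <= tr (v * v * y).
Proof.
move=> hv py; rewrite -mulrA trC; apply: psd_tr_ge0.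
by rewrite -{1}hv; apply: psd_conj.
Qed.

End Trace.

(** * Euler's approximation of the real exponential *)

Section ScalarExp.
Context {R : realType}.

Lemma bernoulli_le (z : R) m : 0 <= z <= 1 -> 1 - m%:R * z <= (1 - z) ^+ m.
Proof.
move=> /andP[z0 z1]; elim: m => [|m IH]; first by rewrite mul0r subr0 expr0.
rewrite exprS -[m.+1]addn1 natrD.
have h : (1 - z) * (1 - m%:R * z) <= (1 - z) * (1 - z) ^+ m.
  by rewrite ler_wpM2l // subr_ge0.
apply: le_trans h; have : 0 <= m%:R :> R by []. nra.
Qed.

(** With [y = r / n], the bound [e^(-y) >= 1 - y] gives
    [1 + y >= e^y (1 - y^2)], and Bernoulli's inequality bounds the [n]-th power. *)
Lemma expR_subr_expn_le (r : R) n : 0 <= r -> r < n%:R ->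
  expR r - (1 + r / n%:R) ^+ n <= expR r * r ^+ 2 / n%:R.
Proof.
move=> r0 rn; have n0 : 0 < n%:R :> R by apply: le_lt_trans rn.
set y := r / n%:R.
have y0 : 0 <= y by rewrite divr_ge0 // ltW.
have y1 : y < 1 by rewrite ltr_pdivrMr // mul1r.
have ry : r = n%:R * y by rewrite /y mulrC divfK // gt_eqF.
have h1 : expR y * (1 - y ^+ 2) <= 1 + y.
  have h : expR y * (1 - y) <= 1.
    rewrite -[leRHS](expRxMexpNx_1 y) ler_wpM2l ?expR_ge0 //.
    exact: expR_ge1Dx.
  have -> : expR y * (1 - y ^+ 2) = (1 + y) * (expR y * (1 - y)) by ring.
  by rewrite -[leRHS]mulr1 ler_wpM2l // addr_ge0.
have y2 : 0 <= y ^+ 2 <= 1 by rewrite sqr_ge0 expr_le1 // ltW.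
have h2 : expR r * (1 - n%:R * y ^+ 2) <= (1 + y) ^+ n.
  rewrite {1}ry expRM_natl.
  apply: (@le_trans _ _ ((expR y * (1 - y ^+ 2)) ^+ n)).
    rewrite (exprMn _ (expR y)); apply: ler_wpM2l; last exact: bernoulli_le.
    exact: exprn_ge0 (expR_ge0 _).
  move/andP: y2 => [_ y2].
  apply: lerXn2r => //; rewrite nnegrE; last exact: addr_ge0.
  by rewrite mulr_ge0 ?expR_ge0 // subr_ge0.
have -> : expR r * r ^+ 2 / n%:R = expR r * (n%:R * y ^+ 2).
  by rewrite /y; field; rewrite gt_eqF.
lra.
Qed.

(** The coefficients of [(1 + x / n)^n] are dominated by those of the exponential
    series; this is why its distance to [e^x] is controlled by a scalar. *)
Lemma binR_div_expn_le n i : 'C(n, i)%:R / n%:R ^+ i <= (i`!%:R)^-1 :> R.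
Proof.
case: n => [|n].
  case: i => [|i]; first by rewrite expr0 divr1 invr1.
  by rewrite bin0n mul0r invr_ge0.
rewrite ler_pdivrMr ?exprn_gt0 ?ltr0n // ler_pdivlMl ?ltr0n ?fact_gt0 //.
rewrite -natrX -natrM ler_nat mulnC bin_ffact.
by elim: i => // i IH; rewrite ffactnSr expnSr leq_mul // leq_subr.
Qed.

Lemma series_exp_coeff_cvg (r : R) : series (exp_coeff r) @ \oo --> expR r.
Proof. exact: is_cvg_series_exp_coeff. Qed.

Lemma series_exp_coeff_nd (r : R) : 0 <= r -> nondecreasing_seq (series (exp_coeff r)).
Proof.
move=> r0; apply: nondecreasing_series => n _ _.
by rewrite /exp_coeff /= divr_ge0 ?exprn_ge0.
Qed.

Lemma expn_le_expR (r : R) n : 0 <= r -> (1 + r / n%:R) ^+ n <= expR r.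
Proof.
case: n => [|n] r0; first by rewrite expr0 -expR0 ler_expR.
have -> : expR r = expR (r / n.+1%:R) ^+ n.+1.
  by rewrite -expRM_natl mulrC divfK // pnatr_eq0.
by rewrite lerXn2r ?nnegrE ?expR_ge0 ?addr_ge0 ?divr_ge0 // expR_ge1Dx.
Qed.

End ScalarExp.

(** * The exponential of a bounded operator *)

Section Exponential.
Context {R : realType} {H : completeNormedModType R[i]}.
Variable dot : {dot H for @Num.conj R[i]}.
Hypothesis dot_norm : hilbert_norm dot.
Variable V : vna dot.
Implicit Types x y z : elt V.
Local Notation ip := (ip dot).

(** A sequence with norm increments dominated by those of a convergent real
    sequence converges inside the algebra. *)
Lemma elt_complete (z : nat -> elt V) (b : R^nat) (B : R) :
  (forall n m, (n <= m)%N -> bnd (op (z m - z n)) (b m - b n)) -> b @ \oo --> B ->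
  exists x : elt V, (forall u, (fun n => op (z n) u) @ \oo --> op x u) /\
    forall n, bnd (op (x - z n)) (B - b n).
Proof.
move=> hz hb.
have b_nd : nondecreasing_seq b.
  by move=> n m /hz[h _]; rewrite -subr_ge0.
have b_le n : b n <= B.
  rewrite -(cvg_lim _ hb) //; apply: nondecreasing_cvgn_le => //.
  by apply/cvg_ex; exists B.
have lim_ex u : exists l : H, (fun n => op (z n) u) @ \oo --> l.
  apply: cauchyH => e e0.
  have u1 : 0 < nrm u + 1 by rewrite ltr_wpDl ?nrm_ge0.
  have /cvgrPdist_lt /(_ (e / (nrm u + 1))) := hb.
  have -> : 0 < e / (nrm u + 1) by rewrite divr_gt0.
  move=> /(_ isT)[n0 _ hn].
  have key n m : (n0 <= n)%N -> (n <= m)%N -> nrm (op (z m) u - op (z n) u) < e.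
    move=> le0 lenm; rewrite -opB; have [h0 h] := hz _ _ lenm.
    apply: (le_lt_trans (h u)).
    have := hn _ le0 => /=; rewrite ltr_pdivlMr //.
    rewrite ger0_norm ?subr_ge0 // => h1.
    by have := b_le m; have := nrm_ge0 u; nra.
  exists n0 => n m hn' hm; have [le_nm|/ltnW le_mn] := leqP n m.
    by rewrite nrmBC; exact: key.
  exact: key.
pose x u : H := sval (cid (lim_ex u)).
have hx u : (fun n => op (z n) u) @ \oo --> x u := svalP (cid (lim_ex u)).
have xB u n : nrm (x u - op (z n) u) <= (B - b n) * nrm u.
  apply: (@lim_nrm_le _ _ _ dot_norm (fun m => op (z m) u - op (z n) u) _ _ n).
    by apply: cvgB; [exact: hx|exact: cvg_cst].
  move=> m lenm; rewrite -opB; apply: le_trans ((hz _ _ lenm).2 u) _.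
  by rewrite ler_wpM2r ?nrm_ge0 // lerB.
have Vx : vset V x.
  apply: (@vset_cvg _ _ _ _ (fun n => op (z n))) => //.
    by move=> n; exact: svalP.
  apply/bounded_opE; split=> [c u v|].
    apply: (@cvgH_unique _ _ (fun n => op (z n) (c *: u + v))); first exact: hx.
    under eq_fun do rewrite op_linear.
    by apply: cvgD; [apply: cvgZ; [exact: cvg_cst|]|]; exact: hx.
  have [C [C0 hC]] := bnd_ex (z 0%N).
  exists (B - b 0%N + C); split=> [|u]; first by rewrite addr_ge0 // subr_ge0.
  rewrite -[x u](subrK (op (z 0%N) u)) mulrDl.
  by apply: (le_trans (ler_nrmD _ _)); apply: lerD; [exact: xB|exact: hC].
exists (mkelt Vx); split; first exact: hx.
by move=> n; split=> [|u]; [rewrite subr_ge0|exact: xB].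
Qed.

Definition exp_sum x n : elt V := \sum_(k < n) ((k`!%:R)^-1)%:C *: x ^+ k.

Lemma exp_sumE x u n :
  series (fun k => (k`!%:R : R[i])^-1 *: iter k (op x) u) n = op (exp_sum x n) u.
Proof.
rewrite /series /= big_mkord /exp_sum op_sum; apply: eq_bigr => k _.
by rewrite opZ opX fmorphV rmorph_nat.
Qed.

Lemma series_exp_coeffE (r : R) n :
  series (exp_coeff r) n = \sum_(k < n) (k`!%:R)^-1 * r ^+ k.
Proof. by rewrite /series /= big_mkord; apply: eq_bigr => k _; rewrite /exp_coeff /= mulrC. Qed.

Lemma bnd_exp_sumB x r n m : bnd (op x) r -> (n <= m)%N ->
  bnd (op (exp_sum x m - exp_sum x n)) (series (exp_coeff r) m - series (exp_coeff r) n).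
Proof.
move=> hx /subnKC <-; elim: (m - n)%N => [|d IH].
  by rewrite addn0 !subrr; exact: bnd0.
rewrite addnS.
have -> : exp_sum x (n + d).+1 - exp_sum x n =
    exp_sum x (n + d) - exp_sum x n + (((n + d)`!%:R)^-1)%:C *: x ^+ (n + d).
  by rewrite /exp_sum big_ord_recr /= addrAC.
have -> : series (exp_coeff r) (n + d).+1 - series (exp_coeff r) n =
    series (exp_coeff r) (n + d) - series (exp_coeff r) n + ((n + d)`!%:R)^-1 * r ^+ (n + d).
  by rewrite !series_exp_coeffE big_ord_recr /= addrAC.
apply: bndD => //.
by apply: bndZ; [rewrite invr_ge0|exact: bndX].
Qed.

Lemma op_exp_ex x r : bnd (op x) r -> exists2 z : elt V, op_exp (op x) = op z &
  (forall u, (fun n => op (exp_sum x n) u) @ \oo --> op z u) /\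
  forall n, bnd (op (z - exp_sum x n)) (expR r - series (exp_coeff r) n).
Proof.
move=> hx.
have [z [hz bz]] := elt_complete (fun n m => bnd_exp_sumB hx) (@series_exp_coeff_cvg R r).
exists z => //; apply/funext => u; rewrite /op_exp; apply: cvg_lim; first exact: norm_hausdorff.
have -> : series (fun k => (k`!%:R : R[i])^-1 *: iter k (op x) u) =
    (fun n => op (exp_sum x n) u) by apply/funext => n; exact: exp_sumE.
exact: hz.
Qed.

Lemma vset_op_exp x : vset V (op_exp (op x)).
Proof. by have [r /op_exp_ex[z -> _]] := bnd_ex x; exact: svalP. Qed.

Definition expe x : elt V := mkelt (vset_op_exp x).

Let expe_props x r : bnd (op x) r ->
  (forall u, (fun n => op (exp_sum x n) u) @ \oo --> op (expe x) u) /\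
  forall n, bnd (op (expe x - exp_sum x n)) (expR r - series (exp_coeff r) n).
Proof.
move=> /op_exp_ex[z e h]; suff -> : expe x = z by [].
by apply: op_inj => u; rewrite -e.
Qed.

Lemma op_exp_cvg x u : (fun n => op (exp_sum x n) u) @ \oo --> op (expe x) u.
Proof. by have [r /expe_props[h _]] := bnd_ex x. Qed.

Lemma bnd_expe x r : bnd (op x) r -> bnd (op (expe x)) (expR r).
Proof.
move=> /expe_props[_ /(_ 0%N)].
by rewrite series_exp_coeffE /exp_sum !big_ord0 !subr0.
Qed.

(** All coefficients of the difference of the two series are nonnegative, so its
    norm is at most the same difference evaluated at a norm bound [r] of [x]. *)
Lemma expe_approx x r n : (0 < n)%N -> bnd (op x) r ->
  bnd (op (expe x - (1 + (n%:R^-1)%:C *: x) ^+ n)) (expR r - (1 + r / n%:R) ^+ n).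
Proof.
move=> n0 hx.
have [_ /(_ n.+1) E1] := expe_props hx.
pose c i : R := (i`!%:R)^-1 - 'C(n, i)%:R / n%:R ^+ i.
have E2 : bnd (op (exp_sum x n.+1 - (1 + (n%:R^-1)%:C *: x) ^+ n))
    (series (exp_coeff r) n.+1 - (1 + r / n%:R) ^+ n).
  have -> : exp_sum x n.+1 - (1 + (n%:R^-1)%:C *: x) ^+ n =
      \sum_(i < n.+1) (c i)%:C *: x ^+ i.
    rewrite exprDn_comm; last exact: commr_sym (commr1 _).
    rewrite /exp_sum -sumrB; apply: eq_bigr => i _.
    rewrite expr1n mul1r /c rmorphB scalerBl; congr (_ - _).
    have -> : ((n%:R^-1)%:C *: x) ^+ i = (n%:R^-1 ^+ i)%:C *: x ^+ i.
      elim: (nat_of_ord i) => [|k IH]; first by rewrite !expr0 scale1r.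
      by rewrite !exprS IH -elt_scaleAl -elt_scaleAr scalerA rmorphM.
    rewrite -scaler_nat scalerA; congr (_ *: _).
    by rewrite exprVn rmorphM rmorph_nat.
  have -> : series (exp_coeff r) n.+1 - (1 + r / n%:R) ^+ n = \sum_(i < n.+1) c i * r ^+ i.
    rewrite exprDn series_exp_coeffE -sumrB; apply: eq_bigr => i _.
    by rewrite expr1n mul1r /c mulrBl exprMn exprVn -[_ *+ 'C(_, _)]mulr_natl; ring.
  apply: (@bnd_sum _ _ _ _ n.+1 (fun i => (c i)%:C *: x ^+ i) (fun i => c i * r ^+ i)) => i _.
  apply: bndZ; last exact: bndX.
  by rewrite subr_ge0; exact: binR_div_expn_le.
have := bndD E1 E2.
by rewrite addrA subrK addrA subrK.
Qed.

Lemma expe0 : expe 0 = 1.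
Proof.
have := expe_approx (ltn0Sn 0) (bnd0 V).
rewrite scaler0 addr0 expr1n mul0r addr0 expr1n expR0 subrr => -[_ h].
apply: op_inj => u; apply/subr0_eq/nrm_eq0/eqP.
by rewrite eq_le nrm_ge0 andbT -opB; have := h u; rewrite mul0r.
Qed.

Lemma expe_limit x r : bnd (op x) r -> forall e, 0 < e ->
  exists n0, forall n, (n0 <= n)%N -> bnd (op (expe x - (1 + (n%:R^-1)%:C *: x) ^+ n)) e.
Proof.
move=> hx e e0.
have K0 : 0 <= expR r * r ^+ 2 by rewrite mulr_ge0 ?expR_ge0 ?sqr_ge0.
pose q := r + expR r * r ^+ 2 / e.
have q0 : 0 <= q by rewrite addr_ge0 ?hx.1 ?divr_ge0 // ltW.
exists (Num.bound q).+1 => n len.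
have qn : q < n%:R.
  apply: (lt_le_trans (archi_boundP q0)); rewrite ler_nat; exact: ltnW.
have n0 : (0 < n)%N by apply: leq_trans len.
have nR : 0 < n%:R :> R by rewrite ltr0n.
apply: bnd_le (expe_approx n0 hx) _.
apply: (le_trans (expR_subr_expn_le hx.1 _)).
  by apply: le_lt_trans qn; rewrite lerDl divr_ge0 // ltW.
rewrite ler_pdivrMr // -ler_pdivrMl // mulrC; apply/ltW; apply: le_lt_trans qn.
by rewrite lerDr hx.1.
Qed.

End Exponential.

(** * The Golden-Thompson inequality *)

Section GoldenThompson.
Context {R : realType} {H : completeNormedModType R[i]}.
Variable dot : {dot H for @Num.conj R[i]}.
Hypothesis dot_norm : hilbert_norm dot.
Variable V : vna dot.
Variable tau : (H -> H) -> R[i].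
Hypothesis tau_state : normal_faithful_tracial_state dot V tau.
Implicit Types x y z : elt V.
Local Notation ip := (ip dot).
Local Notation expe := (expe dot_norm).
Local Notation tr := (tr tau).

Lemma adj_expe x : adj x = x -> adj (expe x) = expe x.
Proof.
move=> hx; have hs n : adj (exp_sum x n) = exp_sum x n.
  elim: n => [|n IH]; rewrite /exp_sum; first by rewrite !big_ord0 -(subrr 1) adjB ?subrr.
  by rewrite !big_ord_recr /= adjD // adjZ // elt_adjX // hx; congr (_ + _); exact: IH.
apply: adj_uniq => // u v.
apply: (@cvg_unique _ _ ((fun n => ip (op (exp_sum x n) u) v) @ \oo)).
- exact: norm_hausdorff.
- by apply: cvg_ip => //; exact: op_exp_cvg.
- have -> : (fun n => ip (op (exp_sum x n) u) v) = (fun n => ip (op (exp_sum x n) v) u).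
    by apply/funext => n; rewrite ip_adj hs ipC.
  by rewrite ipC; apply: cvg_ip => //; exact: op_exp_cvg.
Qed.

(** Even powers of [1 + x / n] are squares of self-adjoint elements.  This replaces
    the identity [e^x = e^(x / 2) e^(x / 2)]. *)
Lemma expe_near_square x : adj x = x -> forall e, 0 < e ->
  exists2 v : elt V, adj v = v & bnd (op (expe x - v * v)) e.
Proof.
move=> hx e e0; have [r hr] := bnd_ex x.
have [n0 hn] := expe_limit dot_norm hr e0.
exists ((1 + ((n0.*2)%:R^-1)%:C *: x) ^+ n0).
  by rewrite elt_adjX // adjD // adjZ // adj1 // hx.
rewrite -exprD addnn; apply: hn; rewrite -addnn; exact: leq_addr.
Qed.

Lemma psd_expe x : adj x = x -> psd (expe x).
Proof.
move=> hx; split=> [|u]; first exact: adj_expe.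
rewrite leNgt; apply/negP => lt0; set q := ip _ _ in lt0.
have u1 : 0 < nrm u ^+ 2 + 1 by rewrite ltr_wpDl ?sqr_ge0.
have d0 : 0 < - q / (nrm u ^+ 2 + 1) by rewrite divr_gt0 ?oppr_gt0.
have [v hv hb] := expe_near_square hx d0.
have [_ /(_ u) pv] : psd (v * v) by rewrite -{1}hv; exact: psd_mul_adj.
have := ip_le_nrm dot_norm (- op (expe x - v * v) u) u.
rewrite ipNl nrmN opB ipBl -/q.
have := hb.2 u; rewrite opB => h1 h2.
have h3 : - q / (nrm u ^+ 2 + 1) * (nrm u ^+ 2 + 1) = - q by rewrite divfK // gt_eqF.
have e0 : 0 < - q / (nrm u ^+ 2 + 1) by rewrite divr_gt0 // oppr_gt0.
move: h1 h2 h3 e0 pv; set e := - q / _; set p := ip _ _; set w := nrm (_ - _).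
have := nrm_ge0 u; nra.
Qed.

(** For [e^x] close to [v * v] this is the positivity of [v y v].  Only the
    quadratic form of [y] enters, since [y] and [adj y] have the same real trace
    against a self-adjoint element. *)
Lemma tr_expe_mul_ge0 x y : adj x = x -> (forall u, 0 <= ip (op y u) u) ->
  0 <= tr (expe x * y).
Proof.
move=> hx py.
have [C hC] := bnd_ex y.
have py2 : psd (y + adj y).
  split=> [|u]; first by rewrite adjD // adjK // addrC.
  by rewrite opD ipDl [ip (op (adj y) u) u]ipC -ip_adj addr_ge0.
have [D hD] := bnd_ex (y + adj y).
have D1 : 0 < D + 1 by rewrite ltr_wpDl ?hD.1.
have : 0 <= tr (expe x * (y + adj y)).
  rewrite -oppr_le0 -(trN tau_state); apply: (tr_le_lim dot_norm tau_state) => e e0.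
  have [v hv hb] := expe_near_square hx (ltac:(by rewrite divr_gt0) : 0 < e / (D + 1)).
  exists (- (v * v * (y + adj y))).
    rewrite -opprD; apply: bndN; rewrite -mulrBl.
    apply: bnd_le (bndM hb hD) _; rewrite mulrAC ler_pdivrMr // ler_wpM2l ?(ltW e0) //.
    by rewrite lerDl.
  rewrite (trN tau_state) oppr_le0; exact: (psd_tr_mul_sqr dot_norm tau_state).
rewrite mulrDr (trD tau_state).
have -> : tr (expe x * adj y) = tr (expe x * y).
  by rewrite -(tr_adj dot_norm tau_state) adjM // adjK // adj_expe // (trC tau_state).
lra.
Qed.

Theorem golden_thompson x y : adj x = x -> adj y = y ->
  tr (expe (x + y)) <= tr (expe x * expe y).
Proof.
move=> hx hy.
have [r [hrx hry]] : exists r, bnd (op x) r /\ bnd (op y) r.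
  have [[r1 h1] [r2 h2]] := (bnd_ex x, bnd_ex y); exists (r1 + r2).
  split; [apply: bnd_le h1 _|apply: bnd_le h2 _]; rewrite ?lerDl ?lerDr.
  - exact: h2.1.
  - exact: h1.1.
have hrxy := bndD hrx hry; have r0 := hrx.1.
pose B := expR r; have B0 : 0 < B := expR_gt0 r.
suff h e : 0 < e -> tr (expe (x + y)) <= tr (expe x * expe y) + (2 + 2 * B) * e.
  rewrite leNgt; apply/negP => lt.
  have B2 : 0 < 2 + 2 * B by lra.
  set d := tr (expe (x + y)) - tr (expe x * expe y).
  have d0 : 0 < d by rewrite subr_gt0.
  have := h (d / 2 / (2 + 2 * B)) (ltac:(by rewrite !divr_gt0)).
  by rewrite mulrC divfK ?gt_eqF // /d; lra.
move=> e0.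
have [n1 h1] := expe_limit dot_norm hrx e0.
have [n2 h2] := expe_limit dot_norm hry e0.
have [n3 h3] := expe_limit dot_norm hrxy e0.
(* The exponent is a power of two, large enough for the three limits and the bound
   on [d^n - (a b)^n]. *)
pose k := (n1 + n2 + n3 + Num.bound (r ^+ 2 * B ^+ 2 / e))%N.
pose n := (2 ^ k)%N.
have lekn : (k <= n)%N by apply/ltnW/ltn_expl.
have n0 : (0 < n)%N by rewrite expn_gt0.
have nR : 0 < n%:R :> R by rewrite ltr0n.
pose c := (n%:R^-1 : R); have c0 : 0 <= c by rewrite invr_ge0.
have q0 : 0 <= c * r by exact: mulr_ge0.
pose a := 1 + c%:C *: x; pose b := 1 + c%:C *: y; pose d := 1 + c%:C *: (x + y).
have D1 : bnd (op (expe (x + y) - d ^+ n)) e.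
  by apply: h3; apply: leq_trans lekn; rewrite /k; lia.
have Dx : bnd (op (expe x - a ^+ n)) e.
  by apply: h1; apply: leq_trans lekn; rewrite /k; lia.
have Dy : bnd (op (expe y - b ^+ n)) e.
  by apply: h2; apply: leq_trans lekn; rewrite /k; lia.
have ba : bnd (op a) (1 + c * r) by apply: bndD; [exact: bnd1|exact: bndZ].
have bb : bnd (op b) (1 + c * r) by apply: bndD; [exact: bnd1|exact: bndZ].
have bab := bndM ba bb.
have bd : bnd (op d) ((1 + c * r) * (1 + c * r)).
  have h := bndD (bnd1 V) (bndZ c0 hrxy); apply: bnd_le h _.
  rewrite mulrDr; move: (c * r) q0 => q q0.
  by rewrite mulrDl mul1r mulrDr mulr1 !addrA lerDl mulr_ge0.
(* The first order terms of [d] and [a * b] agree. *)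
have dab : bnd (op (d - a * b)) (c * c * (r * r)).
  have -> : d - a * b = - ((c * c)%:C *: (x * y)).
    have -> : (c * c)%:C *: (x * y) = (c%:C *: x) * (c%:C *: y).
      by rewrite -elt_scaleAl -elt_scaleAr scalerA rmorphM.
    rewrite /d /a /b scalerDr; move: (c%:C *: x) (c%:C *: y) => X Y.
    apply/eqP; rewrite subr_eq mulrDl mul1r mulrDr mulr1 (addrC X (X * Y)).
    by rewrite [(1 + Y) + _]addrCA addKr addrA addrAC.
  apply: bndN; apply: bndZ; [exact: mulr_ge0|exact: bndM].
have cn : n%:R * c = 1 by rewrite divff // gt_eqF.
have pB : (1 + c * r) ^+ n <= B by rewrite mulrC; exact: expn_le_expR.
have D2 : bnd (op (d ^+ n - (a * b) ^+ n)) e.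
  have := bnd_exprB n.-1 bd bab dab; rewrite prednK // => h; apply: bnd_le h _.
  have P0 : ((1 + c * r) * (1 + c * r)) ^+ n.-1 <= B ^+ 2.
    have P1 : ((1 + c * r) * (1 + c * r)) ^+ n <= B ^+ 2.
      by rewrite exprMn expr2; apply: ler_pM => //; rewrite exprn_ge0 // addr_ge0.
    apply: le_trans P1; apply: ler_weXn2l; last exact: leq_pred.
    by rewrite -[leLHS]mulr1; apply: ler_pM => //; rewrite lerDl.
  have P1 : r ^+ 2 * B ^+ 2 <= e * n%:R.
    rewrite -ler_pdivrMl // mulrC.
    have t0 : 0 <= r ^+ 2 * B ^+ 2 / e by apply: divr_ge0 (ltW e0); apply: mulr_ge0; exact: sqr_ge0.
    apply/ltW/(lt_le_trans (archi_boundP t0)); rewrite ler_nat.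
    by apply: leq_trans lekn; rewrite /k; lia.
  have -> : n%:R * (c * c * (r * r)) = c * r ^+ 2 by rewrite -!mulrA mulrA cn mul1r expr2.
  apply: (@le_trans _ _ (c * (r ^+ 2 * B ^+ 2))).
    by rewrite -!mulrA; do 3!apply: ler_wpM2l => //.
  apply: (le_trans (ler_wpM2l c0 P1)).
  by rewrite mulrCA [c * _]mulrC cn mulr1.
have bbn : bnd (op (b ^+ n)) B by apply: bnd_le (bndX n bb) pB.
have D3 : bnd (op (a ^+ n * b ^+ n - expe x * expe y)) (e * B + B * e).
  have -> : a ^+ n * b ^+ n - expe x * expe y =
      (a ^+ n - expe x) * b ^+ n + expe x * (b ^+ n - expe y).
    by rewrite mulrBl mulrBr addrA subrK.
  apply: bndD; apply: bndM => //.
  - by rewrite -opprB; exact: bndN.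
  - exact: bnd_expe.
  - by rewrite -opprB; exact: bndN.
have ha : adj a = a by rewrite adjD // adjZ // adj1 // hx.
have hb : adj b = b by rewrite adjD // adjZ // adj1 // hy.
have T : tr ((a * b) ^+ n) <= tr (a ^+ n * b ^+ n).
  apply: (trace_expr_mul_le (adj := @adj _ _ _ V)) => //.
  - exact: adjB.
  - exact: adjM.
  - exact: adjK.
  - exact: trB.
  - exact: trC.
  - exact: tr_adj.
  - move=> z; exact: (psd_tr_ge0 tau_state) (psd_mul_adj dot_norm z).
have := bnd_tr dot_norm tau_state D1; have := bnd_tr dot_norm tau_state D2.
have := bnd_tr dot_norm tau_state D3; rewrite !(trB tau_state); lra.
Qed.

End GoldenThompson.

(** * Bounds on the mean of a finite measure *)

Section MeanBounds.
Context {R : realType}.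
Local Notation T := (measurableTypeR R).
Variables (mu : {measure set T -> \bar R}) (r : R).
Hypothesis mu_setT : mu setT = r%:E.
Hypothesis mu_int : mu.-integrable setT (fun t : T => t%:E).

Let int_cst (c : R) : mu.-integrable setT (fun _ : T => c%:E).
Proof.
apply/integrableP; split; first exact: measurable_cst.
have -> : (fun _ : T => `|c%:E|%E) = cst `|c|%:E by [].
by rewrite integral_cst // mu_setT -EFinM ltry.
Qed.

Let RcstE c : \int[mu]_(t in [set: T]) c = c * r.
Proof.
rewrite /Rintegral; have -> : (fun _ : T => c%:E) = cst c%:E by [].
by rewrite integral_cst // mu_setT -EFinM.
Qed.

Let off_null (F : set T) : measurable F -> mu (~` F) = 0%E ->
  \int[mu]_(t in [set: T]) (t : R) = \int[mu]_(t in F) (t : R) /\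
  forall c : R, \int[mu]_(t in [set: T]) c = \int[mu]_(t in F) c.
Proof.
move=> mF F0; have mC : measurable (~` F) by exact: measurableC.
have e : setT `\` ~` F = F by rewrite setTD setCK.
by split=> [|c]; rewrite /Rintegral (negligible_integral mC _ _ F0) ?e.
Qed.

Let int_sub (F : set T) (f : T -> \bar R) : measurable F ->
  mu.-integrable setT f -> mu.-integrable F f.
Proof. by move=> mF; apply: integrableS => //; exact: measurableT. Qed.

Lemma mean_ge (F : set T) c : measurable F -> mu (~` F) = 0%E ->
  (forall t : T, F t -> c <= (t : R)) -> c * r <= \int[mu]_(t in [set: T]) (t : R).
Proof.
move=> mF F0 h; have [-> e] := off_null mF F0; rewrite -RcstE e.
by apply: le_Rintegral => //; apply: int_sub => //; exact: int_cst.
Qed.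

Lemma mean_le (F : set T) c : measurable F -> mu (~` F) = 0%E ->
  (forall t : T, F t -> (t : R) <= c) -> \int[mu]_(t in [set: T]) (t : R) <= c * r.
Proof.
move=> mF F0 h; have [-> e] := off_null mF F0; rewrite -RcstE e.
by apply: le_Rintegral => //; apply: int_sub => //; exact: int_cst.
Qed.

End MeanBounds.

(** * Spectral measures *)

Section SpectralMeasure.
Context {R : realType} {H : completeNormedModType R[i]}.
Variable dot : {dot H for @Num.conj R[i]}.
Hypothesis dot_norm : hilbert_norm dot.
Local Notation ip := (ip dot).
Variables (s : H -> H) (P : set R -> H -> H).
Hypothesis s_lin : linear s.
Hypothesis s_adj : forall u v, ip (s u) v = ip u (s v).
Hypothesis PS : spectral_measure dot s P.

Lemma sm_lin (B : set R) : measurable B -> linear (P B).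
Proof. by move=> mB; case: (sm_proj PS mB) => [[[]]]. Qed.

Lemma sm_bounded (B : set R) : measurable B -> bounded_op (P B).
Proof. by move=> mB; case: (sm_proj PS mB) => [[]]. Qed.

Lemma sm_adj (B : set R) : measurable B -> forall u v, ip (P B u) v = ip u (P B v).
Proof. by move=> mB u v; case: (sm_proj PS mB) => [[_ h] _]; rewrite /ip h. Qed.

Lemma sm_mul (A B : set R) u : measurable A -> measurable B -> P A (P B u) = P (A `&` B) u.
Proof. by move=> mA mB; rewrite (sm_setI PS). Qed.

Lemma sm_comm (A B : set R) u : measurable A -> measurable B -> P A (P B u) = P B (P A u).
Proof. by move=> mA mB; rewrite !sm_mul // setIC. Qed.

Lemma sm_idem (B : set R) u : measurable B -> P B (P B u) = P B u.
Proof. by move=> mB; rewrite sm_mul // setIid. Qed.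

Lemma sm_ip (B : set R) u : measurable B -> ip (P B u) u = ip (P B u) (P B u).
Proof. by move=> mB; rewrite -[in LHS](sm_idem u mB) sm_adj // sm_idem. Qed.

Lemma sm_set0 u : P set0 u = 0.
Proof.
have [mu [hmu _ _]] := sm_integral PS u.
apply: (ip_eq0 dot_norm); rewrite -sm_ip //.
have := hmu set0 measurable0; rewrite measure0 => -[].
by rewrite /ip => <-.
Qed.

Lemma sm_disjoint (A B : set R) u : measurable A -> measurable B -> A `&` B = set0 ->
  P A (P B u) = 0.
Proof. by move=> mA mB e; rewrite sm_mul // e sm_set0. Qed.

Lemma sm_setC (B : set R) u : measurable B -> P B u + P (~` B) u = u.
Proof.
move=> mB; have mC := measurableC mB.
apply/eqP; rewrite -subr_eq0; apply/eqP.
apply: (quad_eq0 dot_norm (y := fun u => P B u + P (~` B) u - u)) => [v w|v w|v].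
- by rewrite (linD (sm_lin mB)) (linD (sm_lin mC)) opprD [X in X + _ = _]addrACA [LHS]addrACA.
- by rewrite !(ipBl, ipBr, ipDl, ipDr, ipNl, ipNr) (sm_adj mB) (sm_adj mC).
- have [mu [hmu _ _]] := sm_integral PS v.
  have : mu (B `|` ~` B) = (mu B + mu (~` B))%E by rewrite measureU // setICr.
  rewrite setUv !hmu // (sm_setT PS) // => -[e].
  by rewrite ipBl ipDl /ip -e subrr.
Qed.

Let int_bounds (F : set R) u (c : R) : measurable F ->
  ((forall t, F t -> c <= t) -> c * ip (P F u) (P F u) <= ip (s (P F u)) (P F u)) /\
  ((forall t, F t -> t <= c) -> ip (s (P F u)) (P F u) <= c * ip (P F u) (P F u)).
Proof.
move=> mF; have [mu [hmu mui e]] := sm_integral PS (P F u).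
have -> : ip (s (P F u)) (P F u) = \int[mu]_(t in setT) t by rewrite /ip e.
have hT : mu setT = (ip (P F u) (P F u))%:E by rewrite hmu // (sm_setT PS).
have hC : mu (~` F) = 0%E.
  rewrite hmu; last exact: measurableC.
  by rewrite sm_disjoint ?setICl //; [rewrite linear0l|exact: measurableC].
by split=> h; [refine (mean_ge hT mui _ hC h)|refine (mean_le hT mui _ hC h)].
Qed.

Lemma sm_ge (F : set R) (c : R) u : measurable F -> (forall t, F t -> c <= t) ->
  c * ip (P F u) (P F u) <= ip (s (P F u)) (P F u).
Proof. by move=> mF; case: (int_bounds u c mF). Qed.

Lemma sm_le (F : set R) (c : R) u : measurable F -> (forall t, F t -> t <= c) ->
  ip (s (P F u)) (P F u) <= c * ip (P F u) (P F u).
Proof. by move=> mF; case: (int_bounds u c mF). Qed.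

(** The measure attached to [u] is the sum of those attached to the two components
    of [u], because the projections commute. *)
Let quad_split (F : set R) u : measurable F ->
  ip (s u) u = ip (s (P F u)) (P F u) + ip (s (P (~` F) u)) (P (~` F) u).
Proof.
move=> mF; have mC := measurableC mF.
have [mu [hmu _ e]] := sm_integral PS u.
have [m1 [hm1 i1 e1]] := sm_integral PS (P F u).
have [m2 [hm2 i2 e2]] := sm_integral PS (P (~` F) u).
rewrite /ip e e1 e2 /=.
have h1 := integrable_fin_num measurableT i1.
have h2 := integrable_fin_num measurableT i2.
rewrite /Rintegral -fineD // -integral_measure_add //.
congr fine; apply: eq_measure_integral => A mA _.
rewrite -[RHS]/(measure_add m1 m2 A) measure_addE hmu // hm1 // hm2 // -EFinD; congr EFin.
rewrite -!/(ip _ _) -[in LHS](sm_setC (P A u) mF) ipDl.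
have e3 (B : set R) : measurable B -> ip (P B (P A u)) u = ip (P A (P B u)) (P B u).
  by move=> mB; rewrite -(sm_idem (P A u) mB) (sm_adj mB) (sm_comm u mB mA).
by rewrite !e3.
Qed.

(** By [quad_split] and polarization, [s] is the sum of its two diagonal blocks. *)
Lemma sm_commute (F : set R) u : measurable F -> P F (s u) = s (P F u).
Proof.
move=> mF; have mC := measurableC mF.
have pL := linD (sm_lin mF); have qL := linD (sm_lin mC); have sL := linD s_lin.
have D0 v : s v - P F (s (P F v)) - P (~` F) (s (P (~` F) v)) = 0.
  apply: (quad_eq0 dot_norm
    (y := fun v => s v - P F (s (P F v)) - P (~` F) (s (P (~` F) v)))) => [w z|w z|w].
  - by rewrite !(pL, qL, sL) !opprD [X in X + _ = _]addrACA [LHS]addrACA.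
  - by rewrite !(ipDl, ipDr, ipNl, ipNr) !(sm_adj mF, sm_adj mC, s_adj).
  - rewrite !ipBl (sm_adj mF) (sm_adj mC) (quad_split w mF); lra.
have D v : s v = P F (s (P F v)) + P (~` F) (s (P (~` F) v)).
  by have /eqP := D0 v; rewrite -addrA -opprD subr_eq0 => /eqP.
have FC v : P F (P (~` F) v) = 0 by rewrite (sm_disjoint _ mF mC) // setICr.
have CF v : P (~` F) (P F v) = 0 by rewrite (sm_disjoint _ mC mF) // setICl.
have -> : P F (s u) = P F (s (P F u)).
  by rewrite {1}(D u) pL FC addr0 sm_idem.
have := D (P F u); rewrite CF (lin0 s_lin) (lin0 (sm_lin mC)) addr0 => ->.
by rewrite !(sm_idem _ mF).
Qed.

End SpectralMeasure.

(** * Operators commuting with a spectrally separated one *)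

Section Separation.
Context {R : realType} {H : completeNormedModType R[i]}.
Variable dot : {dot H for @Num.conj R[i]}.
Hypothesis dot_norm : hilbert_norm dot.
Local Notation ip := (ip dot).

Lemma geometric_bound (a q C : R) : 0 <= q < 1 -> 0 <= C ->
  (forall n, a <= C * q ^+ n) -> a <= 0.
Proof.
move=> /andP[q0 q1] C0 h; rewrite leNgt; apply/negP => a0.
have C1 : 0 < C + 1 by rewrite ltr_wpDl.
have /cvgrPdist_lt /(_ (a / (C + 1))) : q ^+ n @[n --> \oo] --> (0 : R).
  by apply: cvg_expr; rewrite ger0_norm.
have -> : 0 < a / (C + 1) by rewrite divr_gt0.
move=> /(_ isT)[n _ hn]; have := hn n (leqnn n) => /=.
rewrite sub0r normrN ger0_norm ?exprn_ge0 // ltr_pdivlMr // => h1.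
have := h n; have := exprn_ge0 n q0; move: (q ^+ n) h1 => z; nra.
Qed.

Variables (S y P Q : H -> H) (alpha beta : R).
Hypothesis S_lin : linear S.
Hypothesis S_adj : forall u v, ip (S u) v = ip u (S v).
Hypothesis S_ge0 : forall u, 0 <= ip (S u) u.
Hypothesis alpha_beta : 0 < beta < alpha.
Hypothesis SP : forall u, P (S u) = S (P u).
Hypothesis SQ : forall u, Q (S u) = S (Q u).
Hypothesis Sy : forall u, y (S u) = S (y u).
Hypothesis P_ge : forall u, alpha * ip (P u) (P u) <= ip (S (P u)) (P u).
Hypothesis Q_le : forall u, ip (S (Q u)) (Q u) <= beta * ip (Q u) (Q u).
Hypothesis P_bounded : bounded_op P.
Hypothesis y_bounded : bounded_op y.

Let P_growth n u : alpha ^+ n * nrm (P u) <= nrm (iter n S (P u)).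
Proof.
have [b0 ab] := andP alpha_beta.
elim: n => [|n IH] in u *; first by rewrite expr0 mul1r.
rewrite iterSr -SP; apply: le_trans (IH _).
rewrite SP exprSr -mulrA; apply: ler_wpM2l; first by rewrite exprn_ge0 // ltW // (lt_trans b0).
have [->|u0] := eqVneq (nrm (P u)) 0; first by rewrite mulr0 nrm_ge0.
have up : 0 < nrm (P u) by rewrite lt_def u0 nrm_ge0.
have := le_trans (P_ge u) (ip_le_nrm dot_norm _ _).
by rewrite -(nrm_sqr dot_norm) expr2 mulrA ler_pM2r.
Qed.

(** Positivity of [S] at [w - S w / beta] gives the operator bound from the bound on
    the quadratic form. *)
Let Q_growth1 u : nrm (S (Q u)) <= beta * nrm (Q u).
Proof.
have [b0 ab] := andP alpha_beta.
rewrite -ler_sqr ?nnegrE ?nrm_ge0 ?mulr_ge0 ?nrm_ge0 ?(ltW b0) // exprMn !(nrm_sqr dot_norm).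
set w := Q u.
have h1 := Q_le u; have h2 := Q_le (S u); rewrite SQ -/w in h1 h2.
have h3 := S_ge0 (w - (beta^-1)%:C *: S w).
move: h3; rewrite (linB S_lin) (linZ S_lin) !(ipBl, ipBr, ipZl, ipZr).
rewrite [ip (S (S w)) w]S_adj.
move: h1 h2; set a := ip (S w) w; set b := ip (S w) (S w); set d := ip (S (S w)) (S w).
move=> h1 h2 h3; have {h3} : b <= beta * a.
  have h4 : beta^-1 * (beta^-1 * d) <= beta^-1 * b.
    by rewrite ler_wpM2l ?invr_ge0 ?(ltW b0) // ler_pdivrMl.
  by rewrite -ler_pdivrMl //; lra.
move/le_trans; apply; rewrite expr2 -mulrA; apply: ler_wpM2l => //; exact: ltW.
Qed.

Let Q_growth n u : nrm (iter n S (Q u)) <= beta ^+ n * nrm (Q u).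
Proof.
have [b0 ab] := andP alpha_beta.
elim: n => [|n IH] in u *; first by rewrite expr0 mul1r.
rewrite iterSr -SQ; apply: (le_trans (IH _)).
rewrite exprSr -mulrA SQ; apply: ler_wpM2l (Q_growth1 u).
by rewrite exprn_ge0 // ltW.
Qed.

(** On the range of [P] the powers [S^n] grow at least like [alpha^n], on the range
    of [Q] at most like [beta^n].  The vector [v = P y Q u] inherits the slow
    growth through [S^n v = P y S^n Q u], so it vanishes. *)
Lemma separated_ranges u : P (y (Q u)) = 0.
Proof.
have [b0 ab] := andP alpha_beta; have a0 := lt_trans b0 ab.
have /bounded_opE[lP [C [C0 hC]]] := P_bounded.
have /bounded_opE[ly [D [D0 hD]]] := y_bounded.
apply/nrm_eq0/eqP; rewrite eq_le nrm_ge0 andbT.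
apply: (@geometric_bound _ (beta / alpha) (C * (D * nrm (Q u)))).
- by rewrite divr_ge0 ?(ltW a0) ?(ltW b0) //= ltr_pdivrMr // mul1r.
- by rewrite !mulr_ge0 ?nrm_ge0.
move=> n; rewrite expr_div_n [X in _ <= X]mulrA ler_pdivlMr ?exprn_gt0 // mulrC.
apply: (le_trans (P_growth n _)).
have -> : iter n S (P (y (Q u))) = P (y (iter n S (Q u))).
  by elim: n => //= n ->; rewrite Sy SP.
apply: (le_trans (hC _)); rewrite -!mulrA; apply: ler_wpM2l => //.
apply: (le_trans (hD _)); apply: ler_wpM2l => //; rewrite mulrC; exact: Q_growth.
Qed.

End Separation.

(** * Spectral projections of half-lines belong to the algebra *)

Section SpectralProjection.
Context {R : realType} {H : completeNormedModType R[i]}.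
Variable dot : {dot H for @Num.conj R[i]}.
Hypothesis dot_norm : hilbert_norm dot.
Local Notation ip := (ip dot).
Variable V : vna dot.
Variables (s : elt V) (P : set R -> H -> H).
Hypothesis s_sa : adj s = s.
Hypothesis PS : spectral_measure dot (op s) P.

Let s_adj u v : ip (op s u) v = ip u (op s v).
Proof. by rewrite ip_adj s_sa. Qed.

Let commS (F : set R) u : measurable F -> P F (op s u) = op s (P F u).
Proof. by move=> mF; exact: (sm_commute dot_norm (op_linear s) s_adj PS). Qed.

(** [separated_ranges] for [s + K] and for [K - s], which are positive for large
    [K]. *)
Lemma spectral_ranges_separated (F G : set R) (c c' : R) y u :
  measurable F -> measurable G -> commutant V y -> c < c' ->
  (forall t, F t -> c' <= t) -> (forall t, G t -> t <= c) ->
  P F (y (P G u)) = 0 /\ P G (y (P F u)) = 0.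
Proof.
move=> mF mG Cy cc hF hG; have [C hC] := bnd_ex s.
have yb : bounded_op y by case: Cy.
have yL := commutant_linear Cy.
have sy v : y (op s v) = op s (y v) by exact: esym (vset_comm (svalP s) Cy v).
have sL := op_linear s.
have FL := sm_lin PS mF; have GL := sm_lin PS mG.
(* Makes [K + s] and [K - s] positive and both pairs of bounds positive. *)
pose K := C + `|c| + `|c'| + 1.
have [cK cK'] : 0 < c + K /\ 0 < K - c'.
  have := ler_norm (- c); rewrite normrN; have := ler_norm c'.
  have := normr_ge0 c; have := normr_ge0 c'; have := hC.1.
  by rewrite /K; split; lra.
have KC : C <= K.
  by have := normr_ge0 c; have := normr_ge0 c'; rewrite /K; lra.
have sbd v : `|ip (op s v) v| <= K * ip v v.
  rewrite ler_norml; have h1 := ip_le_nrm dot_norm (op s v) v.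
  have h2 := ip_le_nrm dot_norm (- op s v) v; rewrite ipNl nrmN in h2.
  have h3 : nrm (op s v) * nrm v <= K * ip v v.
    rewrite -(nrm_sqr dot_norm) expr2 mulrA ler_wpM2r ?nrm_ge0 //.
    by apply: (le_trans (hC.2 v)); rewrite ler_wpM2r ?nrm_ge0.
  by apply/andP; split; lra.
pose S1 v := op s v + K%:C *: v; pose S2 v := K%:C *: v - op s v.
split.
- apply: (@separated_ranges _ _ dot dot_norm S1 y (P F) (P G) (c' + K) (c + K)) => //.
  + by move=> a v w; rewrite /S1 sL scalerDr scalerDr !scalerA mulrC addrACA.
  + by move=> v w; rewrite /S1 !(ipDl, ipDr, ipZl, ipZr) s_adj.
  + by move=> v; rewrite /S1 ipDl ipZl; have := sbd v; rewrite ler_norml => /andP[]; lra.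
  + by rewrite cK ltrD2r.
  + by move=> v; rewrite /S1 (linD FL) (linZ FL) commS.
  + by move=> v; rewrite /S1 (linD GL) (linZ GL) commS.
  + by move=> v; rewrite /S1 (linD yL) (linZ yL) sy.
  + by move=> v; rewrite /S1 ipDl ipZl (mulrDl _ K) lerD2r; apply: (sm_ge dot_norm PS).
  + by move=> v; rewrite /S1 ipDl ipZl (mulrDl _ K) lerD2r; apply: (sm_le dot_norm PS).
  + exact: (sm_bounded PS).
- apply: (@separated_ranges _ _ dot dot_norm S2 y (P G) (P F) (K - c) (K - c')) => //.
  + move=> a v w; rewrite /S2 sL scalerBr scalerDr !scalerA opprD addrACA.
    by rewrite [K%:C * a]mulrC.
  + by move=> v w; rewrite /S2 !(ipBl, ipBr, ipZl, ipZr) s_adj.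
  + by move=> v; rewrite /S2 ipBl ipZl; have := sbd v; rewrite ler_norml => /andP[]; lra.
  + by rewrite cK' ltrD2l ltrN2.
  + by move=> v; rewrite /S2 (linB GL) (linZ GL) commS.
  + by move=> v; rewrite /S2 (linB FL) (linZ FL) commS.
  + by move=> v; rewrite /S2 (linB yL) (linZ yL) sy.
  + by move=> v; rewrite /S2 ipBl ipZl (mulrBl _ K) lerD2l lerN2; apply: (sm_le dot_norm PS).
  + by move=> v; rewrite /S2 ipBl ipZl (mulrBl _ K) lerD2l lerN2; apply: (sm_ge dot_norm PS).
  + exact: (sm_bounded PS).
Qed.

(** A partition of the open half-line into pieces at positive distance from [c]:
    the half-line itself is not separated from its complement. *)
Let slice (c : R) : (set R)^nat := seqDU (fun k => `]c + k.+1%:R^-1, +oo[%classic).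

Let slice_measurable c k : measurable (slice c k).
Proof. by apply: seqDU_measurable => j; exact: measurable_itv. Qed.

Let slice_ge c k t : slice c k t -> c + k.+1%:R^-1 <= t.
Proof. by case=> /=; rewrite in_itv /= andbT => /ltW. Qed.

Let slice_cover c : `]c, +oo[%classic = \bigcup_k slice c k.
Proof.
rewrite -seqDU_bigcup_eq; apply/seteqP; split=> t /=; rewrite ?in_itv /= ?andbT.
  move=> ct; exists (Num.bound (t - c)^-1) => //=; rewrite in_itv /= andbT.
  have tc : 0 < t - c by rewrite subr_gt0.
  rewrite addrC -ltrBrDr invf_plt ?posrE ?ltr0n //.
  apply: lt_trans (archi_boundP _) _; first by rewrite invr_ge0 ltW.
  by rewrite ltr_nat.
by move=> [k _] /=; rewrite !in_itv /= !andbT; apply: le_lt_trans; rewrite lerDl.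
Qed.

Let slice_cvg c u : series (fun k => P (slice c k) u) @ \oo --> P `]c, +oo[%classic u.
Proof.
rewrite slice_cover; apply: (sm_sigma_additive PS); first exact: slice_measurable.
exact: trivIset_seqDU.
Qed.

(** The off-diagonal blocks of an operator of the commutant vanish: each slice is
    separated from the complement of the half-line, and the slices sum up. *)
Lemma spectral_half_line_mem c : vset V (P `]c, +oo[%classic).
Proof.
set F := `]c, +oo[%classic; have mF : measurable F by exact: measurable_itv.
have mC := measurableC mF.
apply: vset_mem; first exact: (sm_bounded PS).
move=> y Cy u; have yL := commutant_linear Cy.
have FL := sm_lin PS mF; have CL := sm_lin PS mC.
have sep k v : P (slice c k) (y (P (~` F) v)) = 0 /\ P (~` F) (y (P (slice c k) v)) = 0.
  have ck : c < c + k.+1%:R^-1 by rewrite ltrDl invr_gt0.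
  have hC t : (~` F) t -> t <= c.
    by move=> /=; rewrite /F /= in_itv /= andbT => /negP; rewrite -leNgt.
  exact: spectral_ranges_separated (slice_measurable c k) mC Cy ck (@slice_ge c k) hC.
have zero1 : P F (y (P (~` F) u)) = 0.
  apply: (@cvgH_unique _ _ (series (fun k => P (slice c k) (y (P (~` F) u))))).
    exact: (@slice_cvg c (y (P (~` F) u))).
  have -> : series (fun k => P (slice c k) (y (P (~` F) u))) = (fun _ => 0).
    by apply/funext => n; rewrite /series /= big1 // => k _; case: (sep k u).
  exact: cvg_cst.
have zero2 : P (~` F) (y (P F u)) = 0.
  have Cyb : bounded_op y by case: Cy.
  have h := bounded_op_cvg (sm_bounded PS mC) (bounded_op_cvg Cyb (@slice_cvg c u)).
  apply: (@cvgH_unique _ _ _ _ _ h).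
  suff -> : (fun n => P (~` F) (y (series (fun k => P (slice c k) u) n))) = (fun _ => 0).
    exact: cvg_cst.
  apply/funext => n; rewrite /series /=; elim: n => [|n IH].
    by rewrite big_geq // (lin0 yL) (lin0 CL).
  by rewrite big_nat_recr //= (linD yL) (linD CL) IH add0r; case: (sep n u).
have e1 : P F (y u) = P F (y (P F u)).
  by rewrite -[in LHS](sm_setC dot_norm PS u mF) (linD yL) (linD FL) zero1 addr0.
by rewrite e1 -[RHS](sm_setC dot_norm PS _ mF) zero2 addr0.
Qed.

End SpectralProjection.

(** * The exponential Markov inequality *)

Section Markov.
Context {R : realType} {H : completeNormedModType R[i]}.
Variable dot : {dot H for @Num.conj R[i]}.
Hypothesis dot_norm : hilbert_norm dot.
Local Notation ip := (ip dot).
Variable V : vna dot.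
Local Notation expe := (expe dot_norm).
Implicit Types s q x y z : elt V.

Lemma comm_expe x y : x * y = y * x -> x * expe y = expe y * x.
Proof.
move=> xy; have hs n : x * exp_sum y n = exp_sum y n * x.
  rewrite /exp_sum mulr_sumr mulr_suml; apply: eq_bigr => k _.
  by rewrite -elt_scaleAr -elt_scaleAl; congr (_ *: _); exact: commrX.
apply: op_inj => u; apply: (@cvgH_unique _ _ (fun n => op (x * exp_sum y n) u)).
  by apply: bounded_op_cvg; [exact: op_bounded|exact: op_exp_cvg].
under eq_fun do rewrite hs.
exact: op_exp_cvg.
Qed.

(** It suffices to bound each power: [s^k >= c^k] on the range of [q], by
    induction in steps of two, since [s^(k+2)] at [q v] is [s^k] at [q (s v)] and
    [(s - c)^2 >= 0] gives [s^2 >= 2 c s - c^2 >= c^2]. *)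
Lemma expe_ge_on_range s q c t : adj s = s -> s * q = q * s -> 0 <= c -> 0 <= t ->
  (forall u, c * ip (op q u) (op q u) <= ip (op s (op q u)) (op q u)) ->
  forall u, expR (t * c) * ip (op q u) (op q u) <= ip (op (expe (t%:C *: s)) (op q u)) (op q u).
Proof.
move=> s_sa sq c0 t0 hq u.
have sqE v : op s (op q v) = op q (op s v) by rewrite -!opM sq.
have pow k v : c ^+ k * ip (op q v) (op q v) <= ip (op (s ^+ k) (op q v)) (op q v).
  elim/ltn_ind: k v => -[|[|k]] IH v.
  - by rewrite !expr0 mul1r.
  - by rewrite !expr1.
  have -> : ip (op (s ^+ k.+2) (op q v)) (op q v) =
            ip (op (s ^+ k) (op q (op s v))) (op q (op s v)).
    by rewrite -sqE exprS opM ip_adj s_sa exprSr opM.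
  apply: le_trans (IH k (leqW (leqnn _)) (op s v)).
  have -> : c ^+ k.+2 = c ^+ k * (c ^+ 2) by rewrite -exprD addn2.
  rewrite -mulrA; apply: ler_wpM2l; first exact: exprn_ge0.
  rewrite -sqE; have h1 := hq v; have := ip_ge0 dot_norm (op s (op q v) - c%:C *: op q v).
  rewrite !(ipBl, ipBr, ipZl, ipZr) (ipC _ (op q v) (op s (op q v))).
  by nra.
have a0 : 0 <= ip (op q u) (op q u) by exact: ip_ge0.
have partial n : series (exp_coeff (t * c)) n * ip (op q u) (op q u) <=
    ip (op (exp_sum (t%:C *: s) n) (op q u)) (op q u).
  elim: n => [|n IH].
    by rewrite series_exp_coeffE /exp_sum !big_ord0 mul0r op0 ip0l.
  have -> : series (exp_coeff (t * c)) n.+1 =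
      series (exp_coeff (t * c)) n + (n`!%:R)^-1 * (t * c) ^+ n.
    by rewrite !series_exp_coeffE big_ord_recr.
  have -> : exp_sum (t%:C *: s) n.+1 =
      exp_sum (t%:C *: s) n + ((n`!%:R)^-1)%:C *: (t%:C *: s) ^+ n.
    by rewrite /exp_sum big_ord_recr.
  rewrite opD ipDl mulrDl; apply: lerD => //.
  have -> : (t%:C *: s) ^+ n = (t ^+ n)%:C *: s ^+ n.
    elim: (n) => [|k IHk]; first by rewrite !expr0 scale1r.
    by rewrite !exprS IHk -elt_scaleAl -elt_scaleAr scalerA rmorphM.
  rewrite !opZ !ipZl exprMn -!mulrA; apply: ler_wpM2l; first by rewrite invr_ge0.
  by apply: ler_wpM2l; [exact: exprn_ge0|exact: pow].
have cv : series (exp_coeff (t * c)) n * ip (op q u) (op q u) @[n --> \oo] -->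
    expR (t * c) * ip (op q u) (op q u).
  by apply: cvgMr_tmp; exact: series_exp_coeff_cvg.
rewrite -(cvg_lim _ cv) //; apply: limr_le; first by apply/cvg_ex; eexists; exact: cv.
near=> n0.
apply: (@lim_ip_ge _ _ _ dot_norm (fun n => op (exp_sum (t%:C *: s) n) (op q u)) _ _ _ n0).
  exact: op_exp_cvg.
move=> n len; apply: le_trans (partial n); apply: ler_wpM2r => //.
by apply: series_exp_coeff_nd => //; exact: mulr_ge0.
Unshelve. all: by end_near.
Qed.

(** As [q] commutes with [e^(t s)], the quadratic form of the latter splits into its
    values at [q u], at least [e^(t c)], and at [(1 - q) u], at least [0]. *)
Lemma spectral_projection_half_line s c : adj s = s -> 0 <= c ->
  exists q : elt V, [/\ op q = spectral_projection dot `]c, +oo[%classic (op s),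
    adj q = q, q * q = q & forall t, 0 < t -> psd (expe (t%:C *: s) - (expR (t * c))%:C *: q)].
Proof.
move=> s_sa c0.
have ts_sa t : adj (t%:C *: s) = t%:C *: s by rewrite adjZ // s_sa.
have [[P PS]|noP] := pselect (exists P, spectral_measure dot (op s) P); last first.
  exists 0; split.
  - rewrite /spectral_projection xgetPN // => P PS; apply: noP; by exists P.
  - by rewrite -(subrr 1) adjB ?subrr.
  - by rewrite mulr0.
  - by move=> t t0; rewrite scaler0 subr0; exact: psd_expe.
have {P}PS : spectral_measure dot (op s) (fun B => spectral_projection dot B (op s)).
  exact: (xgetPex _ (ex_intro _ P PS)).
set F := `]c, +oo[%classic.
have mF : measurable F by exact: measurable_itv.
have Vp : vset V (spectral_projection dot F (op s)).
  exact: (spectral_half_line_mem dot_norm s_sa PS).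
pose q : elt V := mkelt Vp.
have q_sa : adj q = q by apply/(selfadjP dot_norm); case: (sm_proj PS mF).
have qq : q * q = q by apply: op_inj => u; exact: (sm_idem PS u mF).
have s_adj u v : ip (op s u) v = ip u (op s v) by rewrite ip_adj s_sa.
have qs : q * s = s * q.
  by apply: op_inj => u; exact: (sm_commute dot_norm (op_linear s) s_adj PS u mF).
exists q; split=> // t t0; split=> [|u].
  by rewrite adjB // adjZ // adj_expe // q_sa.
set e := expe _.
have qe : q * e = e * q.
  by apply: comm_expe; rewrite -elt_scaleAr -elt_scaleAl qs.
have h1 : expR (t * c) * ip (op q u) (op q u) <= ip (op e (op q u)) (op q u).
  apply: expe_ge_on_range => //; first exact: ltW.
  by move=> v; apply: (sm_ge dot_norm PS v mF) => x; rewrite /F /= in_itv /= andbT => /ltW.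
have [_ /(_ (op (1 - q) u)) h2] := psd_expe dot_norm (ts_sa t).
have h3 : ip (op e u) u = ip (op e (op q u)) (op q u) + ip (op e (op (1 - q) u)) (op (1 - q) u).
  have cross : ip (op e (op q u)) (op (1 - q) u) = 0.
    by rewrite -opM -qe opM ip_adj q_sa -opM mulrBr mulr1 qq subrr op0 ip0r.
  have cross' : ip (op e (op (1 - q) u)) (op q u) = 0.
    by rewrite ipC ip_adj q_sa -!opM qe -mulrA mulrBr mulr1 qq subrr mulr0 op0 ip0r.
  transitivity (ip (op e (op q u + op (1 - q) u)) (op q u + op (1 - q) u)).
    by rewrite -opD addrC subrK op1.
  move: (op (1 - q) u) (op q u) cross cross' => w v cross cross'.
  rewrite (linD (op_linear e)) !(ipDl, ipDr) cross cross'; lra.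
rewrite opB opZ ipBl ipZl h3.
have -> : ip (op q u) u = ip (op q u) (op q u) by rewrite [RHS]ip_adj q_sa -opM qq ipC.
by move: h1 h2; lra.
Qed.

End Markov.

(** * Powers of a positive contraction *)

Section Contraction.
Context {R : realType} {H : completeNormedModType R[i]}.
Variable dot : {dot H for @Num.conj R[i]}.
Hypothesis dot_norm : hilbert_norm dot.
Local Notation ip := (ip dot).
Variable V : vna dot.
Implicit Types x y z : elt V.

(** Conjugation by [x] raises the exponent by two. *)
Lemma psd_exprM x y n : adj x = x -> psd y -> psd (x * y) -> x * y = y * x ->
  psd (x ^+ n * y).
Proof.
move=> hx py pxy xy; elim/ltn_ind: n => -[|[|n]] IH; first by rewrite expr0 mul1r.
  by rewrite expr1.
have -> : x ^+ n.+2 * y = adj x * (x ^+ n * y) * x.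
  rewrite hx exprSr exprS -!mulrA; congr (_ * (_ * _)).
  by rewrite xy.
by apply: psd_conj => //; apply: IH.
Qed.

Variable T : elt V.
Hypothesis psdT : psd T.
Hypothesis psd1T : psd (1 - T).
Let h := 1 - T.

Let h_sa : adj h = h. Proof. by case: psd1T. Qed.
Let T_sa : adj T = T. Proof. by case: psdT. Qed.
Let hT : h * T = T * h. Proof. by rewrite /h mulrBl mulrBr mul1r mulr1. Qed.

Let psd_hT : psd (h * T).
Proof.
have -> : h * T = adj T * h * T + adj h * T * h.
  have e1 : T = h * T + T * T by rewrite -mulrDl /h subrK mul1r.
  rewrite h_sa T_sa -hT -[h * T * h]mulrA -hT -mulrA.
  by rewrite -mulrDr addrC -e1.
by apply: psdD => //; apply: psd_conj.
Qed.

Lemma psd_hX n : psd (h ^+ n).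
Proof.
rewrite -[h ^+ n]mulr1; apply: psd_exprM => //; first exact: psd1.
- by rewrite mulr1.
- by rewrite mulr1 mul1r.
Qed.

Lemma psd_hXT n : psd (h ^+ n * T).
Proof. exact: psd_exprM. Qed.

Lemma psd_hXB n m : (n <= m)%N -> psd (h ^+ n - h ^+ m).
Proof.
move=> /subnKC <-; elim: (m - n)%N => [|d IH].
  rewrite addn0 subrr; have := psd_conj dot_norm 0 (psd1 dot_norm V).
  by rewrite mulr0.
have -> : h ^+ n - h ^+ (n + d.+1) = h ^+ n - h ^+ (n + d) + h ^+ (n + d) * T.
  have -> : h ^+ (n + d) * T = h ^+ (n + d) - h ^+ (n + d.+1).
    by rewrite addnS exprSr /h mulrBr mulr1 opprB addrCA subrr addr0.
  by rewrite addrA subrK.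
by apply: psdD => //; exact: psd_hXT.
Qed.

Lemma bnd_h : bnd (op h) 1.
Proof.
split=> // u; rewrite mul1r -ler_sqr ?nnegrE ?nrm_ge0 // !(nrm_sqr dot_norm).
have [_ /(_ u)] := psd_hXB (isT : (0 <= 2)%N).
by rewrite expr0 opB op1 ipBl subr_ge0 expr2 opM [ip (op h (op h u)) u]ip_adj h_sa.
Qed.

Lemma bnd_hX n : bnd (op (h ^+ n)) 1.
Proof. by rewrite -(expr1n _ n); exact: bndX bnd_h. Qed.

Lemma hX_ip n m u : ip (op (h ^+ n) u) (op (h ^+ m) u) = ip (op (h ^+ (n + m)) u) u.
Proof. by rewrite addnC exprD opM [RHS]ip_adj elt_adjX // h_sa. Qed.

(** The moments [ip (h^n u) u] decrease to a limit, and
    [|h^n u - h^m u|^2] is the combination of those of orders [2n], [2m] and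
    [n + m], the last with coefficient [-2]. *)
Lemma powers_cvg u : exists l : H, (fun n => op (h ^+ n) u) @ \oo --> l.
Proof.
pose mo n := ip (op (h ^+ n) u) u.
have mo_ni : nonincreasing_seq mo.
  move=> n m lenm; rewrite /mo -subr_ge0 -ipBl -opB.
  by have [_ /(_ u)] := psd_hXB lenm.
have mo_ge0 n : 0 <= mo n by have [_ /(_ u)] := psd_hX n.
have mo_cvg : cvgn mo.
  by apply: nonincreasing_is_cvgn => //; exists 0 => _ [n _ <-].
apply: cauchyH => e e0.
have e2 : 0 < e ^+ 2 / 2 by rewrite divr_gt0 // exprn_gt0.
have /cvgrPdist_lt /(_ _ e2)[n0 _ hn] := mo_cvg.
exists n0 => n m len lem.
have mo_le k : limn mo <= mo k by exact: nonincreasing_cvgn_ge.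
have mo_lt k : (n0 <= k)%N -> mo k < limn mo + e ^+ 2 / 2.
  move=> /hn /=; rewrite distrC ger0_norm ?subr_ge0 // => lt_e.
  by rewrite -ltrBlDl.
rewrite -ltr_sqr ?nnegrE ?nrm_ge0 ?(ltW e0) // (nrm_sqr dot_norm).
rewrite !(ipBl, ipBr) !hX_ip -!/(mo _).
have := mo_lt (n + n)%N (leq_trans len (leq_addr _ _)).
have := mo_lt (m + m)%N (leq_trans lem (leq_addr _ _)).
have := mo_le (n + m)%N; have := mo_le (m + n)%N; lra.
Qed.

(** The limit is the projection onto the vectors fixed by [h], the kernel of [T]. *)
Lemma power_limit_projection : exists q : elt V,
  [/\ adj q = q, q * q = q, T * q = 0
    & forall u, (fun n => op (h ^+ n) u) @ \oo --> op q u].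
Proof.
pose f u : H := sval (cid (powers_cvg u)).
have hf u : (fun n => op (h ^+ n) u) @ \oo --> f u := svalP (cid (powers_cvg u)).
have Vf : vset V f.
  apply: (@vset_cvg _ _ _ _ (fun n => op (h ^+ n))) => //.
    by move=> n; exact: svalP.
  apply/bounded_opE; split=> [c u v|].
    apply: (@cvgH_unique _ _ (fun n => op (h ^+ n) (c *: u + v))); first exact: hf.
    under eq_fun do rewrite op_linear.
    by apply: cvgD; [apply: cvgZ; [exact: cvg_cst|]|]; exact: hf.
  exists 1; split=> // u.
  apply: (@lim_nrm_le _ _ _ dot_norm (fun n => op (h ^+ n) u) _ _ 0) => // n _.
  exact: (bnd_hX n).2.
pose q : elt V := mkelt Vf.
have hq : h * q = q.
  apply: op_inj => u; apply: (@cvgH_unique _ _ (fun n => op h (op (h ^+ n) u))).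
    by apply: bounded_op_cvg; [exact: op_bounded|exact: hf].
  have -> : (fun n => op h (op (h ^+ n) u)) = (fun n => op (h ^+ (n + 1)) u).
    by apply/funext => n; rewrite addn1 exprS opM.
  by rewrite (cvg_shiftn 1 (fun n => op (h ^+ n) u)); exact: hf.
have hnq n : h ^+ n * q = q.
  by elim: n => [|n IH]; [rewrite expr0 mul1r|rewrite exprSr -mulrA hq].
exists q; split=> //.
- apply: (adj_uniq dot_norm) => u v.
  apply: (@cvg_unique _ _ ((fun n => ip (op (h ^+ n) u) v) @ \oo)).
  + exact: norm_hausdorff.
  + by apply: cvg_ip => //; exact: hf.
  + have -> : (fun n => ip (op (h ^+ n) u) v) = (fun n => ip (op (h ^+ n) v) u).
      by apply/funext => n; rewrite ip_adj elt_adjX // h_sa ipC.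
    by rewrite ipC; apply: cvg_ip => //; exact: hf.
- apply: op_inj => u; apply: (@cvgH_unique _ _ (fun n => op (h ^+ n) (op q u))).
    exact: hf.
  have -> : (fun n => op (h ^+ n) (op q u)) = (fun _ => op q u).
    by apply/funext => n; rewrite -opM hnq.
  exact: cvg_cst.
- have : (1 - h) * q = 0 by rewrite mulrBl mul1r hq subrr.
  by rewrite /h opprB addrCA subrr addr0.
Qed.

(** The partial sums of the Neumann series of the inverse of [T]. *)
Let geo K := \sum_(j < K) h ^+ j.

Lemma one_minus_hX K : 1 - h ^+ K = T * geo K.
Proof.
rewrite /geo mulr_sumr; elim: K => [|K IH]; first by rewrite big_ord0 expr0 subrr.
rewrite big_ord_recr /= -IH exprS.
have -> : T = 1 - h by rewrite /h opprB addrCA subrr addr0.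
by rewrite [X in _ = _ + X]mulrBl mul1r addrA subrK.
Qed.

Let psd_sum_hX n m : psd (\sum_(j < n) h ^+ (j + m)).
Proof.
elim: n => [|n IH].
  have := psd_conj dot_norm 0 (psd1 dot_norm V); rewrite mulr0.
  by rewrite big_ord0.
by rewrite big_ord_recr /=; apply: psdD => //; exact: psd_hX.
Qed.

Lemma psd_geo K : psd (geo K).
Proof.
have := psd_sum_hX K 0; congr psd; apply: eq_bigr => j _; by rewrite addn0.
Qed.

Lemma bnd_geo K : bnd (op (geo K)) K%:R.
Proof.
have := @bnd_sum _ _ _ V K (fun j => h ^+ j) (fun _ => 1).
rewrite sumr_const card_ord; apply=> i _; exact: bnd_hX.
Qed.

(** Here [X = geo K] satisfies [X T X <= X].  Put [v = p u].  Then
    [c |p X v|^2 <= ip (T X v) (X v) <= ip (X v) v <= |p X v| |v|], so that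
    [c |p X v| <= |v|] and [c * ip (X v) v <= |v|^2]. *)
Lemma compression_le p c K : adj p = p -> p * p = p -> 0 < c -> psd (T - c%:C *: p) ->
  psd (p - c%:C *: (p * geo K * p)).
Proof.
move=> p_sa pp c0 [_ hp]; have [X_sa pX] := psd_geo K; set X := geo K in X_sa pX *.
split=> [|u]; first by rewrite adjB // adjZ // !adjM // p_sa X_sa mulrA.
(* [X - X T X = X (1 - T)^K], a sum of powers of [1 - T]. *)
have pXTX : psd (X - X * T * X).
  have -> : X - X * T * X = \sum_(j < K) h ^+ (j + K).
    rewrite -mulrA -one_minus_hX mulrBr mulr1 opprB addrCA subrr addr0 /X /geo mulr_suml.
    by apply: eq_bigr => j _; rewrite exprD.
  exact: psd_sum_hX.
set v := op p u.
have vE : op p v = v by rewrite /v -opM pp.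
rewrite opB opZ ipBl ipZl !opM -/v [ip (op p _) u]ip_adj p_sa -/v.
have -> : ip v u = ip v v by rewrite -{1}vE ip_adj p_sa.
rewrite subr_ge0 -(nrm_sqr dot_norm v).
have [_ /(_ v)] := pXTX; rewrite opB !opM ipBl [ip (op X (op T _)) v]ip_adj X_sa subr_ge0.
have := hp (op X v); rewrite opB opZ ipBl ipZl subr_ge0.
have -> : ip (op p (op X v)) (op X v) = nrm (op p (op X v)) ^+ 2.
  by rewrite (nrm_sqr dot_norm) [RHS]ip_adj p_sa -[op p (op p _)]opM pp ipC.
have : ip (op X v) v <= nrm (op p (op X v)) * nrm v.
  by apply: le_trans (ip_le_nrm dot_norm _ _); rewrite [leRHS]ip_adj p_sa vE.
have := nrm_ge0 (op p (op X v)); have := nrm_ge0 v.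
move: (nrm (op p _)) (nrm v) (ip (op X v) v) (ip (op T _) _) => al nv be ga nv0 al0 h1 h2 h3.
have h4 : c * al ^+ 2 <= al * nv by lra.
have h5 : c * al <= nv \/ al = 0.
  have [->|al1] := eqVneq al 0; [by right|left].
  have al2 : 0 < al by rewrite lt_def al1.
  by rewrite -(ler_pM2l al2); lra.
case: h5 => [h5|h5]; last by rewrite h5 in h1 *; nra.
nra.
Qed.

End Contraction.

(** * The trace of a supremum of projections *)

Section Supremum.
Context {R : realType} {H : completeNormedModType R[i]}.
Variable dot : {dot H for @Num.conj R[i]}.
Hypothesis dot_norm : hilbert_norm dot.
Local Notation ip := (ip dot).
Variable V : vna dot.
Variable tau : (H -> H) -> R[i].
Hypothesis tau_state : normal_faithful_tracial_state dot V tau.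
Implicit Types x y z : elt V.
Local Notation tr := (tr tau).

Lemma psd_idem x : adj x = x -> x * x = x -> psd x.
Proof. by move=> hx xx; have := psd_mul_adj dot_norm x; rewrite hx xx. Qed.

Lemma psd_projB x y : adj x = x -> x * x = x -> adj y = y -> y * y = y -> x * y = 0 ->
  psd (1 - x - y).
Proof.
move=> hx xx hy yy xy.
have yx : y * x = 0 by rewrite -hx -hy -adjM // xy -(subrr 1) adjB ?subrr.
apply: psd_idem; first by rewrite !adjB // adj1 // hx hy.
rewrite !mulrBl !mulrBr !mul1r !mulr1 xx xy yx yy !subr0.
by rewrite subrr subr0 subrr subr0.
Qed.

Variables (p : nat -> elt V) (W : R).
Hypothesis p_sa : forall k, adj (p k) = p k.
Hypothesis pp : forall k, p k * p k = p k.
Hypothesis sum_le : forall K, \sum_(k < K) tr (p k) <= W.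

Let c k : R := 2^-1 ^+ k.+1.
Let c_gt0 k : 0 < c k. Proof. by rewrite exprn_gt0 // invr_gt0. Qed.
Let psd_p k : psd (p k). Proof. exact: psd_idem. Qed.
Let psd_1p k : psd (1 - p k).
Proof.
apply: psd_idem; first by rewrite adjB // adj1 // p_sa.
by rewrite mulrBl !mulrBr !mul1r mulr1 pp subrr subr0.
Qed.

Let bnd_p k : bnd (op (p k)) 1.
Proof.
split=> // u; rewrite mul1r -ler_sqr ?nnegrE ?nrm_ge0 // !(nrm_sqr dot_norm).
have [_ /(_ u)] := psd_1p k; rewrite opB op1 ipBl subr_ge0 => h.
by rewrite [leLHS]ip_adj p_sa -opM pp ipC.
Qed.

Let Tn n : elt V := \sum_(k < n) (c k)%:C *: p k.
Let b n : R := \sum_(k < n) c k.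

Let TnS n : Tn n.+1 = Tn n + (c n)%:C *: p n.
Proof. by rewrite /Tn big_ord_recr. Qed.

Let bE n : b n = 1 - 2^-1 ^+ n.
Proof.
rewrite /b; elim: n => [|n IH]; first by rewrite big_ord0 expr0 subrr.
by rewrite big_ord_recr /= IH /c exprS; lra.
Qed.

Let b_cvg : b @ \oo --> (1 : R).
Proof.
have -> : b = (fun n => 1 - 2^-1 ^+ n) by apply/funext => n; exact: bE.
rewrite -[X in _ --> X]subr0; apply: cvgB; first exact: cvg_cst.
by apply: cvg_expr; rewrite ger0_norm ?invr_ge0 // invf_lt1 // ltr1n.
Qed.

Let Tn_sub n m : (n <= m)%N -> psd (Tn m - Tn n) /\ bnd (op (Tn m - Tn n)) (b m - b n).
Proof.
move=> /subnKC <-; elim: (m - n)%N => [|d [IH1 IH2]].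
  rewrite addn0 !subrr; split; last exact: bnd0.
  by have := psd_conj dot_norm 0 (psd1 dot_norm V); rewrite mulr0.
have -> : Tn (n + d.+1) - Tn n = Tn (n + d) - Tn n + (c (n + d))%:C *: p (n + d).
  by rewrite addnS TnS addrAC.
have -> : b (n + d.+1) - b n = b (n + d) - b n + c (n + d) * 1.
  by rewrite addnS /b big_ord_recr /= mulr1 addrAC.
split; first by apply: psdD => //; apply: psdZ (ltW (c_gt0 _)) _.
by apply: bndD => //; apply: bndZ (ltW (c_gt0 _)) _.
Qed.

Let total : exists T : elt V, [/\ psd T, psd (1 - T), forall k, psd (T - (c k)%:C *: p k)
  & forall n, bnd (op (T - Tn n)) (2^-1 ^+ n)].
Proof.
have [T [hT bT]] := elt_complete dot_norm (fun n m le => (Tn_sub le).2) b_cvg.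
have ipT n u : ip (op (Tn n) u) u <= ip (op T u) u.
  apply: (@lim_ip_ge _ _ _ dot_norm (fun m => op (Tn m) u) _ _ _ n); first exact: hT.
  by move=> m lenm; have [[_ /(_ u)]] := Tn_sub lenm; rewrite opB ipBl subr_ge0.
have Tn_sa n : adj (Tn n) = Tn n.
  elim: n => [|n IH]; last by rewrite TnS adjD // adjZ // p_sa IH.
  by rewrite /Tn big_ord0 -(subrr 1) adjB ?subrr.
have T_sa : adj T = T.
  apply: (adj_uniq dot_norm) => u v.
  apply: (@cvg_unique _ _ ((fun n => ip (op (Tn n) u) v) @ \oo)).
  - exact: norm_hausdorff.
  - by apply: cvg_ip => //; exact: hT.
  - have -> : (fun n => ip (op (Tn n) u) v) = (fun n => ip (op (Tn n) v) u).
      by apply/funext => n; rewrite ip_adj Tn_sa ipC.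
    by rewrite ipC; apply: cvg_ip => //; exact: hT.
have Tn_ge0 n u : 0 <= ip (op (Tn n) u) u.
  have [[_ /(_ u)]] := Tn_sub (leq0n n).
  by rewrite opB [op (Tn 0) u](_ : _ = 0) ?subr0 // /Tn big_ord0.
exists T; split.
- by split=> // u; apply: le_trans (ipT 0%N u).
- split=> [|u]; first by rewrite adjB // adj1 // T_sa.
  rewrite opB op1 ipBl subr_ge0 -(nrm_sqr dot_norm) expr2.
  apply: le_trans (ip_le_nrm dot_norm _ _) _; apply: ler_wpM2r; first exact: nrm_ge0.
  have [_ /(_ u)] := bT 0%N.
  by rewrite /b /Tn !big_ord0 !subr0 mul1r.
- move=> k; split=> [|u]; first by rewrite adjB // adjZ // T_sa p_sa.
  rewrite opB ipBl subr_ge0; apply: le_trans (ipT k.+1 u).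
  by rewrite TnS opD ipDl lerDr.
- by move=> n; have := bT n; rewrite bE opprB addrCA subrr addr0.
Qed.

(** Any projection above all [p k] would bound the supremum; this one has a trace
    that can be computed. *)
Let join_ex : exists e : elt V, [/\ adj e = e, e * e = e, forall k, psd (e - p k)
  & tr e <= W].
Proof.
have [T [pT p1T hpT hTn]] := total.
have [q [q_sa qq Tq hq]] := power_limit_projection dot_norm pT p1T.
have pq k : p k * q = 0.
  apply: op_inj => u; rewrite op0; apply: (ip_eq0 dot_norm).
  have [_ /(_ (op q u))] := hpT k; rewrite opB opZ ipBl ipZl subr_ge0 -[op T (op q u)]opM Tq.
  rewrite op0 ip0l pmulr_rle0 // => h.
  apply/eqP; rewrite eq_le ip_ge0 // andbT; apply: le_trans h.
  by rewrite !opM [leLHS]ip_adj p_sa -[op (p k) (op (p k) _)]opM pp ipC.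
have e_sa : adj (1 - q) = 1 - q by rewrite adjB // adj1 // q_sa.
have ee : (1 - q) * (1 - q) = 1 - q.
  by rewrite mulrBl !mulrBr !mul1r mulr1 qq subrr subr0.
pose h := 1 - T; pose X K := \sum_(j < K) h ^+ j.
have h_sa : adj h = h by case: p1T.
have trK K : tr (1 - h ^+ K) <= W.
  have -> : 1 - h ^+ K = T * X K by exact: one_minus_hX.
  have Tn_le n : tr (Tn n * X K) <= W.
    apply: le_trans (sum_le n); rewrite /Tn mulr_suml.
    elim: n => [|n IH]; first by rewrite !big_ord0 (tr0 tau_state).
    rewrite !big_ord_recr /= (trD tau_state); apply: lerD => //.
    have := @compression_le _ _ _ dot_norm _ _ p1T _ _ K (p_sa n) (pp n) (c_gt0 n) (hpT n).
    move/(psd_tr_ge0 tau_state).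
    rewrite (trB tau_state) (trZ tau_state) subr_ge0 -elt_scaleAl (trZ tau_state).
    by rewrite (trC tau_state) mulrA pp.
  apply: (tr_le_lim dot_norm tau_state) => eps eps0.
  pose n := Num.bound (K%:R / eps).
  exists (Tn n * X K) => //; rewrite -mulrBl.
  have := bndM (hTn n) (bnd_geo dot_norm pT p1T K); move/bnd_le; apply.
  have n2 : K%:R / eps < 2 ^+ n.
    apply: lt_trans (archi_boundP _) _; first by rewrite divr_ge0 // ltW.
    by rewrite -natrX ltr_nat ltn_expl.
  rewrite exprVn ler_pdivrMl ?exprn_gt0 // -ler_pdivrMr //; exact: ltW.
exists (1 - q); split=> //.
  by move=> k; rewrite addrAC; apply: psd_projB.
have hXq k : forall u, ip (op q u) u <= ip (op (h ^+ k) u) u.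
  move=> u; apply: (@lim_ip_le _ _ _ dot_norm (fun m => op (h ^+ m) u) _ _ _ k); first exact: hq.
  by move=> m le; have [_ /(_ u)] := psd_hXB dot_norm pT p1T le; rewrite opB ipBl subr_ge0.
have hX_sa k : adj (1 - h ^+ k) = 1 - h ^+ k by rewrite adjB // adj1 // elt_adjX // h_sa.
pose D := [set op (1 - h ^+ k) | k in [set: nat]].
have lubD : is_lub (op_le dot) (selfadjoint_part dot V) D (op (1 - q)).
  split.
  - by split; [exact: svalP|exact/(selfadjP dot_norm)].
  - move=> _ [k _ <-]; apply/(op_leP (hX_sa k) e_sa) => u.
    by rewrite !opB !ipBl lerD2l lerN2.
  - move=> w [Vw w_sa] hw; pose w' : elt V := mkelt Vw.
    have {}w_sa : adj w' = w' by apply/(selfadjP dot_norm).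
    apply/(op_leP (y := w') e_sa w_sa) => u; rewrite opB ipBl op1.
    have : ip u u - ip (op w' u) u <= ip (op q u) u.
      apply: (@lim_ip_ge _ _ _ dot_norm (fun m => op (h ^+ m) u) _ _ _ 0); first exact: hq.
      move=> m _; have /(op_leP (y := w') (hX_sa m) w_sa)/(_ u) := hw _ (ex_intro2 _ _ m I erefl).
      by rewrite opB ipBl op1; lra.
    lra.
have dirD : directed (op_le dot) D.
  split; first by exists (op (1 - h ^+ 0)); exists 0%N.
  have mono j k : (j <= k)%N -> op_le dot (op (1 - h ^+ j)) (op (1 - h ^+ k)).
    move=> le; apply/(op_leP (hX_sa j) (hX_sa k)) => u.
    rewrite !opB !ipBl lerD2l lerN2.
    by have [_ /(_ u)] := psd_hXB dot_norm pT p1T le; rewrite opB ipBl subr_ge0.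
  move=> _ _ [j _ <-] [k _ <-]; exists (op (1 - h ^+ maxn j k)); first by exists (maxn j k).
  by split; apply: mono; [exact: leq_maxl|exact: leq_maxr].
have DM : D `<=` selfadjoint_part dot V.
  by move=> _ [k _ <-]; split; [exact: svalP|exact/(selfadjP dot_norm)].
have [_ _ /(_ W%:C I)] := state_normal tau_state DM dirD lubD.
rewrite (tau_selfadj dot_norm tau_state e_sa) lecR; apply.
move=> _ [_ [k _ <-] <-].
by rewrite (tau_selfadj dot_norm tau_state (hX_sa k)) lecR.
Qed.

(** The supremum defaults to [0] when it does not exist. *)
Theorem tau_projection_sup_le (D : set (H -> H)) :
  (forall w, D w -> exists k, w = op (p k)) -> tau (projection_sup dot V D) <= W%:C.
Proof.
move=> hD.
have W0 : 0 <= W by have := sum_le 0; rewrite big_ord0.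
have [[L hL]|noL] := pselect (exists L, is_lub (op_le dot) (V `&` projection dot) D L); last first.
  rewrite /projection_sup xgetPN; last by move=> L hL; apply: noL; exists L.
  have adj0 : adj (0 : elt V) = 0 by rewrite -(subrr 1) adjB ?subrr.
  have -> : (0 : H -> H) = op (0 : elt V) by apply/funext.
  rewrite (tau_selfadj dot_norm tau_state adj0).
  by rewrite (tr0 tau_state) lecR.
have : is_lub (op_le dot) (V `&` projection dot) D (projection_sup dot V D).
  exact: (xgetPex _ (ex_intro _ L hL)).
move: (projection_sup dot V D) => {hL}L [[VL [L_sa _]] _ Lmin].
have [e [e_sa ee pe tre]] := join_ex.
have {}Lmin : op_le dot L (op e).
  apply: Lmin.
    split; first exact: svalP.
    by split; [exact/(selfadjP dot_norm)|apply/funext => u; rewrite /= -opM ee].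
  move=> _ /hD[k ->]; apply/(op_leP (p_sa k) e_sa) => u.
  by have [_ /(_ u)] := pe k; rewrite opB ipBl subr_ge0.
pose L' : elt V := mkelt VL.
have {}L_sa : adj L' = L' by apply/(selfadjP dot_norm).
rewrite -/(op L') (tau_selfadj dot_norm tau_state L_sa) lecR; apply: le_trans tre.
rewrite -subr_ge0 -(trB tau_state); apply: (psd_tr_ge0 tau_state); split=> [|u].
  by rewrite adjB // e_sa L_sa.
by have /(op_leP (x := L') L_sa e_sa)/(_ u) := Lmin; rewrite opB ipBl subr_ge0.
Qed.

End Supremum.

(** * One step of the supermartingale *)

Section Step.
Context {R : realType} {H : completeNormedModType R[i]}.
Variable dot : {dot H for @Num.conj R[i]}.
Hypothesis dot_norm : hilbert_norm dot.
Variables V W : vna dot.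
Variable tau : (H -> H) -> R[i].
Hypothesis tau_state : normal_faithful_tracial_state dot V tau.
Hypothesis WV : vset W `<=` vset V.
Variable E : (H -> H) -> (H -> H).
Hypothesis E_ce : conditional_expectation dot V tau W E.
Local Notation tr := (tr tau).
Local Notation ip := (ip dot).
Local Notation expe := (expe dot_norm).
Implicit Types x y z : elt V.

(** Conditioning on [W] after Golden-Thompson: [e^z] lies in [W], so it can be
    taken out of the conditional expectation. *)
Lemma tr_expe_add_le z y (f : R) : vset W (op z) -> adj z = z -> adj y = y ->
  op_le dot (E (op_exp (op y))) (f%:C *: id) ->
  tr (expe (z + y)) <= f * tr (expe z).
Proof.
move=> Wz hz hy le_f; apply: (le_trans (golden_thompson dot_norm tau_state hz hy)).
have WE : vset W (E (op_exp (op y))) by apply: (ce_range E_ce); exact: svalP (expe y).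
have Wexp : vset W (op_exp (op z)) by exact: (vset_op_exp dot_norm (mkelt Wz)).
pose g : elt V := mkelt (WV WE).
have -> : tr (expe z * expe y) = tr (expe z * g).
  rewrite /tr -(ce_trace E_ce (svalP (expe z * expe y))).
  have := ce_bimodule E_ce (svalP (expe y)) Wexp (vset1 W).
  by move=> /(congr1 tau)/(congr1 (@complex.Re R)).
have := tr_expe_mul_ge0 dot_norm tau_state (y := f%:C *: (1 : elt V) - g) hz.
rewrite mulrBr -elt_scaleAr mulr1 (trB tau_state) (trZ tau_state) subr_ge0; apply=> u.
by have := le_f u; rewrite lecE => /andP[_].
Qed.

End Step.

(** * Geometric tails *)

Section Numeric.
Context {R : realType}.

Lemma exists_expn_le (r e : R) : 0 <= r < 1 -> 0 < e -> exists2 i : nat, (1 <= i)%N & r ^+ i <= e.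
Proof.
move=> /andP[r0 r1] e0.
have /cvgrPdist_lt /(_ e e0)[n _ hn] : r ^+ n @[n --> \oo] --> (0 : R).
  by apply: cvg_expr; rewrite ger0_norm.
exists n.+1 => //; have := hn n.+1 (leqnSn n) => /=.
by rewrite sub0r normrN ger0_norm ?exprn_ge0 // => /ltW.
Qed.

Lemma geometric_tail_le (r C : R) N K : 0 <= r < 1 -> 0 <= C ->
  \sum_(k < K) C * r ^+ (N + k) <= C * r ^+ N / (1 - r).
Proof.
move=> /andP[r0 r1] C0; have q0 : 0 < 1 - r by rewrite subr_gt0.
rewrite ler_pdivlMr // mulrC.
have -> : (1 - r) * \sum_(k < K) C * r ^+ (N + k) = C * r ^+ N - C * r ^+ (N + K).
  elim: K => [|K IH]; first by rewrite big_ord0 mulr0 addn0 subrr.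
  by rewrite big_ord_recr /= mulrDr IH addnS exprS; ring.
by rewrite gerBl mulr_ge0 // exprn_ge0.
Qed.

End Numeric.

(** * The maximal inequality *)

Theorem theorem2p2 (R : realType) (H : completeNormedModType R[i])
    (dot : {dot H for @Num.conj R[i]}) (M : set (H -> H)) (tau : (H -> H) -> R[i])
    (N : nat -> set (H -> H)) (E : nat -> (H -> H) -> (H -> H))
    (x s : nat -> H -> H) (lambda gamma : R) (f : R -> R) (a b : R) :
  hilbert_norm dot ->
  von_neumann_algebra dot M ->
  normal_faithful_tracial_state dot M tau ->
  filtration dot M tau N E ->
  (forall n, s n = \sum_(1 <= i < n.+1) x i) ->
  supermartingale dot N E s ->
  0 < lambda -> 0 <= gamma ->
  {within `[0, +oo[, continuous f} ->
  (forall t, 0 <= t -> 0 < f t) ->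
  (forall (n : nat) (t : R), (1 <= n)%N -> 0 < t ->
     op_le dot (E n.-1 (op_exp (t%:C *: x n))) ((f t)%:C *: id) /\
     f t <= expR (- gamma * t + lambda * t ^+ 2)) ->
  0 < a -> 0 < b ->
  let t0 := (b + gamma) / lambda in
  let A := expR (- b * t0) * f t0 in
  let t0' := (b + gamma) / (2 * lambda) in
  let A0 := expR (- (1 / 2) * (b - gamma) * t0') * f t0' in
  [/\ A <= 1,
      exists2 i : nat, (1 <= i)%N & forall m : nat, (1 <= m)%N ->
        tau (projection_sup dot M
               [set spectral_projection dot `]a + b * n%:R, +oo[ (s n)
                 | n in [set n : nat | (m + i <= n)%N]])
        <= (A ^+ m * expR (- a * (b + gamma) / lambda))%:C
    & exists2 j : nat, (1 <= j)%N & forall m : nat, (1 <= m)%N ->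
        tau (projection_sup dot M
               [set spectral_projection dot `]b * n%:R, +oo[ (s n)
                 | n in [set n : nat | (m + j <= n)%N]])
        <= (A0 ^+ m * expR (- m%:R * (b + gamma) ^+ 2 / (4 * lambda)))%:C].
Proof.
move=> dot_norm hM tau_state hF hs [s_sa _] lambda0 gamma0 _ f0 hf a0 b0 t0 A t0' A0.
pose V := Vna hM; pose VN n := Vna (filt_vna hF n).
have Ms n : M (s n) by apply: (filt_sub hF (n := n)); case: (s_sa n).
have tauS : normal_faithful_tracial_state dot V tau := tau_state.
pose sM n : elt V := mkelt (V := V) (Ms n).
have sM_sa n : adj (sM n) = sM n by apply/(selfadjP dot_norm); case: (s_sa n).
have tsM_sa t n : adj (t%:C *: sM n) = t%:C *: sM n by rewrite adjZ // sM_sa.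
have xE n : x n.+1 = op (sM n.+1 - sM n).
  apply/funext => u; rewrite opB /= !hs big_nat_recr //=.
  set S := \sum_(_ <= _ < _) _; rewrite -[RHS]/(S u + x n.+1 u - S u).
  by rewrite addrC addKr.
have f_le t : 0 < t -> f t <= expR (- gamma * t + lambda * t ^+ 2).
  by move=> t_gt0; have [] := hf 1%N t isT t_gt0.
have decay t n : 0 < t -> tr tau (expe dot_norm (t%:C *: sM n)) <= f t ^+ n.
  move=> t_gt0; elim: n => [|n IH].
    have -> : sM 0%N = 0 by apply: op_inj => u; rewrite /= hs big_geq.
    by rewrite scaler0 expe0 (tr1 tauS) expr0.
  rewrite exprS; apply: le_trans (ler_wpM2l (ltW (f0 _ (ltW t_gt0))) IH).
  have -> : t%:C *: sM n.+1 = t%:C *: sM n + t%:C *: (sM n.+1 - sM n).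
    by rewrite -scalerDr addrC subrK.
  apply: (@tr_expe_add_le _ _ _ dot_norm V (VN n) _ tauS _ (E n)) => //.
  - exact: (filt_sub hF).
  - exact: (filt_ce hF).
  - by apply: (vsetZ (V := VN n)); case: (s_sa n).
  - by rewrite adjZ // adjB // !sM_sa.
  - have -> : op (t%:C *: (sM n.+1 - sM n)) = t%:C *: x n.+1 by rewrite xE.
    by have [] := hf n.+1 t isT t_gt0.
have sup_bound (c : nat -> R) t C r N0 : 0 < t -> (forall n, 0 <= c n) -> 0 <= C ->
    0 <= r < 1 -> (forall n, expR (- (t * c n)) * f t ^+ n <= C * r ^+ n) ->
    tau (projection_sup dot M [set spectral_projection dot `]c n, +oo[ (s n)
      | n in [set n : nat | (N0 <= n)%N]]) <= (C * r ^+ N0 / (1 - r))%:C.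
  move=> t_gt0 c0 C0 r01 hr.
  have /choice[q hq] n := spectral_projection_half_line dot_norm (sM_sa n) (c0 n).
  have trq n : tr tau (q n) <= C * r ^+ n.
    have [_ _ _ /(_ t t_gt0)] := hq n.
    move/(psd_tr_ge0 tauS); rewrite (trB tauS) (trZ tauS) subr_ge0 => h.
    apply: le_trans (hr n); rewrite expRN ler_pdivlMl ?expR_gt0 //.
    exact: le_trans h (decay t n t_gt0).
  apply: (@tau_projection_sup_le _ _ _ dot_norm V tau tauS (fun k => q (N0 + k)%N)).
  - by move=> k; have [] := hq (N0 + k)%N.
  - by move=> k; have [] := hq (N0 + k)%N.
  - move=> K; apply: le_trans (geometric_tail_le N0 K r01 C0).
    by apply: ler_sum => k _; exact: trq.
  - move=> _ [n /= le_n <-]; exists (n - N0)%N; rewrite subnKC //.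
    by have [-> _ _ _] := hq n.
have bg0 : 0 < b + gamma by exact: ltr_wpDr.
pose g t := expR (- b * t) * f t.
have g_gt0 t : 0 < t -> 0 < g t by move=> h; rewrite mulr_gt0 ?expR_gt0 ?f0 // ltW.
have g_le t : 0 < t -> g t <= expR (t * (lambda * t - (b + gamma))).
  move=> t_gt0; have -> : t * (lambda * t - (b + gamma)) =
      - b * t + (- gamma * t + lambda * t ^+ 2) by ring.
  by rewrite expRD ler_wpM2l ?expR_ge0 ?f_le.
have g_lt1 t : 0 < t -> lambda * t < b + gamma -> g t < 1.
  move=> t_gt0 lt; apply: le_lt_trans (g_le t t_gt0) _.
  by rewrite expR_lt1 pmulr_rlt0 // subr_lt0.
have g_bound c1 t n : expR (- (t * (c1 + b * n%:R))) * f t ^+ n = expR (- (t * c1)) * g t ^+ n.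
  rewrite /g exprMn mulrA; congr (_ * _).
  by rewrite -expRM_natl -expRD; congr expR; ring.
have t0_gt0 : 0 < t0 by rewrite divr_gt0.
have t0E : lambda * t0 = b + gamma by rewrite mulrC divfK // gt_eqF.
have Ag : A = g t0 by [].
have A_gt0 : 0 < A by rewrite Ag g_gt0.
have A_le1 : A <= 1.
  by rewrite Ag; apply: le_trans (g_le _ t0_gt0) _; rewrite t0E subrr mulr0 expR0.
split=> //.
- set K := expR (- a * _ / _); have K0 : 0 < K by exact: expR_gt0.
  have c0 n : 0 <= a + b * n%:R by rewrite addr_ge0 ?mulr_ge0 // ltW.
  (* If [A = 1] the exponent [t0] gives no decay. *)
  have [A1|A_lt1] := eqVneq A 1; last first.
    have A01 : 0 <= A < 1 by rewrite ltW //= lt_neqAle A_lt1.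
    have hq : 0 < 1 - A by case/andP: A01 => _; rewrite subr_gt0.
    have [i i1 hi] := exists_expn_le A01 hq.
    exists i => // m m1.
    apply: le_trans (@sup_bound (fun n => a + b * n%:R) t0 K A (m + i)%N
      t0_gt0 c0 (ltW K0) A01 _) _.
      move=> n; rewrite g_bound -Ag /K; have -> : - (t0 * a) = - a * (b + gamma) / lambda.
        by rewrite /t0; ring.
      by [].
    rewrite lecR ler_pdivrMr // exprD mulrA [K * _]mulrC.
    by apply: ler_wpM2l hi; rewrite mulr_ge0 ?exprn_ge0 ?ltW.
  (* Halving [t0] makes [lambda * t - (b + gamma)] negative. *)
  have t1_gt0 : 0 < t0 / 2 by rewrite divr_gt0.
  have r1 : g (t0 / 2) < 1 by apply: g_lt1 => //; rewrite mulrA t0E ltr_pdivrMr //; lra.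
  have r01 : 0 <= g (t0 / 2) < 1 by rewrite r1 ltW // g_gt0.
  set r := g (t0 / 2) in r1 r01; pose C := expR (- (t0 / 2 * a)).
  have C0 : 0 < C by exact: expR_gt0.
  have q0 : 0 < 1 - r by rewrite subr_gt0.
  have [i i1 hi] := exists_expn_le r01 (divr_gt0 (mulr_gt0 K0 q0) C0).
  exists i => // m m1.
  apply: le_trans (@sup_bound (fun n => a + b * n%:R) (t0 / 2) C r (m + i)%N
    t1_gt0 c0 (ltW C0) r01 _) _.
    by move=> n; rewrite g_bound.
  rewrite lecR A1 expr1n mul1r ler_pdivrMr // exprD mulrCA.
  rewrite -[leRHS]mul1r; case/andP: r01 => r0 _; apply: ler_pM.
  + exact: exprn_ge0.
  + by rewrite mulr_ge0 ?exprn_ge0 // ltW.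
  + by apply: exprn_ile1 => //; exact: ltW.
  + by rewrite mulrC -ler_pdivlMr.
- have t1_gt0 : 0 < t0' by rewrite divr_gt0 // mulr_gt0.
  have t1E : lambda * t0' = (b + gamma) / 2.
    by rewrite /t0'; field; rewrite gt_eqF.
  have r1 : g t0' < 1 by apply: g_lt1 => //; rewrite t1E; lra.
  have r01 : 0 <= g t0' < 1 by rewrite r1 ltW // g_gt0.
  have c0 n : 0 <= b * n%:R by rewrite mulr_ge0 // ltW.
  have q0 : 0 < 1 - g t0' by rewrite subr_gt0.
  have [j j1 hj] := exists_expn_le r01 q0.
  exists j => // m m1.
  apply: le_trans (@sup_bound (fun n => b * n%:R) t0' 1 (g t0') (m + j)%N t1_gt0 c0 ler01 r01 _) _.
    by move=> n; rewrite -[b * n%:R]add0r g_bound mulr0 oppr0 expR0.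
  have -> : A0 ^+ m * expR (- m%:R * (b + gamma) ^+ 2 / (4 * lambda)) = g t0' ^+ m.
    have -> : - m%:R * (b + gamma) ^+ 2 / (4 * lambda) = m%:R * (- ((b + gamma) / 2 * t0')).
      by rewrite /t0'; field; rewrite gt_eqF.
    rewrite expRM_natl -exprMn; congr (_ ^+ _).
    by rewrite /A0 /g mulrAC -expRD; congr (expR _ * _); lra.
  rewrite lecR ler_pdivrMr // mul1r exprD ler_wpM2l ?exprn_ge0 //.
  by case/andP: r01.
Qed.
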